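(* Let $m,b,s,s',t,t'$ be positive integers with $s'\geq s\geq 2m+1$, $m\leq b$, $t'\geq t\geq \lceil s/m\rceil$ and $t'\geq \lceil s'/m\rceil$. Then there exists a hypergraph $\mathcal{H}=(X,\mathcal{F})$ with the following properties: (1) If Maker is the first player in the $(m:b)$ Maker-Breaker game on $\mathcal{H}$, then she has a strategy to occupy a winning set of size $s$ within $t$ rounds, but (against optimal play of Breaker) she can neither win within fewer than $t$ rounds nor occupy a winning set of size smaller than $s$. (2) If Maker is the second player in the $(m:b)$ Maker-Breaker game on $\mathcal{H}$, then she has a strategy to occupy a winning set of size $s'$ within $t'$ rounds, but she can neither win within fewer than $t'$ rounds nor occupy a winning set of size smaller than $s'$.
   Context: For a hypergraph $\mathcal{H}=(X,\mathcal{F})$ and integers $m,b\geq 1$, the $(m:b)$ Maker-Breaker game on $\mathcal{H}$: Maker and Breaker alternate in moves; in each move Maker claims up to $m$ unclaimed elements of $X$ and Breaker claims up to $b$ unclaimed elements of $X$. The hyperedges of $\mathcal{F}$ are the winning sets; Maker wins once she has claimed all elements of some winning set, and Breaker wins otherwise. A round consists of one move of each player. *)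

(* Defs.v *)
From mathcomp Require Import all_boot.

Set Implicit Arguments.
Unset Strict Implicit.
Unset Printing Implicit Defensive.

Definition ceil_div (n d : nat) : nat := (n + d.-1) %/ d.

Lemma ceil_div_leq (n d k : nat) :
  0 < d -> (ceil_div n d <= k) = (n <= k * d).
Proof.
case: d => // d _; rewrite /ceil_div /= -ltnS ltn_divLR // mulSn.
by rewrite -addnS addnC leq_add2l.
Qed.

(* A hypergraph is a finite vertex type T together with its family
   F : {set {set T}} of winning sets. *)

Notation player := bool.
Definition Maker : player := true.
Definition Breaker : player := false.

(* The moves made so far, oldest first: who moved, and the elements claimed. *)
Definition history (T : finType) : Type := seq (player * {set T}).

Definition claimed (T : finType) (p : player) (h : history T) : {set T} :=
  \bigcup_(x <- h | x.1 == p) x.2.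

Definition strategy (T : finType) : Type := history T -> {set T}.

(* "Up to k unclaimed elements": claiming fewer, or none, is allowed, so that
   a legal move exists after every history and legality can be required
   everywhere. *)
Definition legal (T : finType) (k : nat) (sigma : strategy T) : Prop :=
  forall h : history T,
    #|sigma h| <= k /\
    [disjoint sigma h & claimed Maker h :|: claimed Breaker h].

Definition maker_won (T : finType) (F : {set {set T}}) (h : history T) : bool :=
  [exists W in F, W \subset claimed Maker h].

(* The history after k single moves when p0 moves first; the play stops as soon
   as Maker has claimed a winning set. *)
Fixpoint play (T : finType) (F : {set {set T}}) (p0 : player)
    (sigma tau : strategy T) (k : nat) : history T :=
  if k is k'.+1 then
    let h := play F p0 sigma tau k' in
    let p := if odd k' then ~~ p0 else p0 in
    if maker_won F h then h
    else rcons h (p, (if p == Maker then sigma else tau) h)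
  else [::].

Definition rounds (T : finType) (F : {set {set T}}) (p0 : player)
    (sigma tau : strategy T) (r : nat) : history T :=
  play F p0 sigma tau r.*2.

Definition maker_can_occupy (T : finType) (F : {set {set T}}) (m b : nat)
    (p0 : player) (s t : nat) : Prop :=
  exists2 sigma : strategy T, legal m sigma &
    forall tau : strategy T, legal b tau ->
      exists W : {set T},
        [/\ W \in F, #|W| = s
          & W \subset claimed Maker (rounds F p0 sigma tau t)].

(* One optimal strategy of Breaker rules out both a win in fewer than t rounds
   and, in any number of rounds, the occupation of a winning set of size
   smaller than s. *)
Definition breaker_can_restrict (T : finType) (F : {set {set T}}) (m b : nat)
    (p0 : player) (s t : nat) : Prop :=
  exists2 tau : strategy T, legal b tau &
    forall sigma : strategy T, legal m sigma ->
      (forall r : nat, r < t -> ~~ maker_won F (rounds F p0 sigma tau r)) /\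
      (forall (r : nat) (W : {set T}), W \in F -> #|W| < s ->
         ~~ (W \subset claimed Maker (rounds F p0 sigma tau r))).

(* Main.v *)
(* Replace every vertex by a block of [m] elements and every edge by [b] winning
   sets that differ only in a small tail.  Then Maker's only useful moves claim a
   whole block, and completing the core of an edge forces Breaker to spend his
   whole move on its [b] tails, while completing two cores at once wins.

   The delay comes from a path of blocks with cores the pairs of neighbours and
   both ends owned by Maker.  For [b >= 2] she has to walk along the path, every
   step being forced; for [b = 1] she bisects it, and needs only logarithmically
   many rounds; choosing the length accordingly gives every number of rounds.
   Breaker holds out by keeping owned blocks that are still connected far apart.
   The ends are identified with a root below which hang [b + 1] such paths, so
   that Breaker's free answer to the root spares one of them; further roots are
   stacked on top to increase the size of the cores.

   Let [A] and [B] be gadgets for [(s, t)] and [(s', t')].  The hypergraph is the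
   disjoint union of [A] and [b + 1] copies of [B].  Moving first, Maker plays on
   [A].  Moving second, she plays on a copy of [B] untouched by Breaker's first
   move, which he does best to use for killing the root of [A]. *)
Require Import Defs.
From mathcomp Require Import all_boot.
From mathcomp Require Import boolp zify.

Set Implicit Arguments.
Unset Strict Implicit.
Unset Printing Implicit Defensive.

(** * Strategies from invariants *)

Lemma claimed_rcons (T : finType) (p p' : player) (h : history T) (S : {set T}) :
  claimed p (rcons h (p', S)) =
  if p' == p then claimed p h :|: S else claimed p h.
Proof.
rewrite /claimed -cats1 big_cat /= big_cons big_nil /=.
by case: ifP => _; rewrite ?setU0.
Qed.

Definition maker_moves (T : finType) (h : history T) : nat :=
  count (fun x => x.1 == Maker) h.

Definition legal_move (T : finType) (k : nat) (M K S : {set T}) : bool :=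
  (#|S| <= k) && [disjoint S & M :|: K].

(** Plays some legal move satisfying [P], decided classically, and passes if there is none; legality
    is thus automatic, and an invariant suffices to define a strategy. *)
Definition choose_move (T : finType) (k : nat) (P : history T -> {set T} -> Prop) :
  strategy T :=
  fun h => odflt set0
    [pick S | legal_move k (claimed Maker h) (claimed Breaker h) S && `[< P h S >]].

Lemma choose_move_legal (T : finType) (k : nat) P : legal k (@choose_move T k P).
Proof.
move=> h; rewrite /choose_move.
case: pickP => [S /andP[/andP[] ] //|_] /=; rewrite cards0; split=> //.
by rewrite disjoints_subset sub0set.
Qed.

Lemma choose_moveP (T : finType) (k : nat) (P : history T -> {set T} -> Prop) h :
  (exists2 S, legal_move k (claimed Maker h) (claimed Breaker h) S & P h S) ->
  P h (choose_move k P h).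
Proof.
case=> S lS PS; rewrite /choose_move; case: pickP => [S' /andP[_ /asboolP] //|].
by move/(_ S); rewrite lS (asboolT PS).
Qed.

Lemma legalP (T : finType) (k : nat) (sigma : strategy T) h :
  legal k sigma ->
  legal_move k (claimed Maker h) (claimed Breaker h) (sigma h).
Proof. by move=> /(_ h) [? ?]; apply/andP. Qed.

(* [I p n M K]: an invariant of the positions with [p] to move and at most [n]
   more moves of Maker to come. *)
Lemma play_inv (T : finType) (F : {set {set T}}) (p0 : player)
    (sigma tau : strategy T) (t : nat)
    (I : player -> nat -> {set T} -> {set T} -> Prop) :
  I p0 t set0 set0 ->
  (forall h, let M := claimed Maker h in let K := claimed Breaker h in
     let n := t - maker_moves h in
     ~~ maker_won F h ->
     (I Maker n M K -> I Breaker n.-1 (M :|: sigma h) K) /\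
     (I Breaker n M K -> I Maker n M (K :|: tau h))) ->
  forall r, let h := rounds F p0 sigma tau r in
  exists2 p, I p (t - maker_moves h) (claimed Maker h) (claimed Breaker h)
    & (maker_moves h <= r) && (maker_won F h || (maker_moves h == r)).
Proof.
move=> I0 Istep r /=.
(* [c k] counts Maker's moves among the first [k] single moves; after an odd number the first player
   is one ahead. *)
pose c k := k./2 + (odd k && p0).
suff /(_ r.*2) [p [Ip]] : forall k, let h := play F p0 sigma tau k in
    exists p, [/\ I p (t - maker_moves h) (claimed Maker h) (claimed Breaker h),
      maker_moves h <= c k
    & maker_won F h ||
      ((p == (if odd k then ~~ p0 else p0)) && (maker_moves h == c k))].
  rewrite /c odd_double /= doubleK addn0 => -> H; exists p => //.
  by case/orP: H => [->|/andP[_ ->]]; rewrite ?orbT.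
elim=> [|k [p [Ip cle IH]]] /=.
  by exists p0; rewrite /claimed !big_nil subn0 eqxx orbT.
have cS : c k.+1 = c k + (if odd k then ~~ p0 else p0).
  by rewrite /c /= uphalf_half; case: (odd k) (p0) => [] [] /=; lia.
case: ifPn => [won|nwon].
  by exists p; rewrite won; split=> //; apply: leq_trans cle _; rewrite cS leq_addr.
rewrite (negPf nwon) /= in IH; case/andP: IH => /eqP-> {p cle} /eqP cnt in Ip *.
set h := play _ _ _ _ _ in Ip nwon cnt *.
have [stepM stepB] := Istep h nwon.
have := Ip; set p := if odd k then ~~ p0 else p0 => Ip'.
have cnt' S : maker_moves (rcons h (p, S)) = c k.+1.
  by rewrite /maker_moves -cats1 count_cat /= addn0 -/(maker_moves h) cnt cS -/p; case: (p).
exists (~~ p); rewrite !claimed_rcons cnt' leqnn eqxx andbT; split=> //.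
  rewrite cS -/p; move: Ip'; case: p {cnt'} => /= Ip'.
    by rewrite -cnt addn1 subnS; exact: stepM.
  by rewrite addn0 -cnt; exact: stepB.
by apply/orP; right; rewrite /p; case: (odd k) => //; rewrite negbK.
Qed.

Lemma legal_move0 (T : finType) (k : nat) (M K : {set T}) : legal_move k M K set0.
Proof. by rewrite /legal_move cards0 disjoints_subset sub0set. Qed.

(** [I] describes positions with Maker to move; at Breaker's turns it is replaced by the existence
    of a reply restoring it. The clock is 0 only after [t] moves of Maker, so a win takes at least
    [t] rounds. *)
Lemma breaker_can_restrict_inv (T : finType) (F : {set {set T}}) (m b : nat)
    (p0 : player) (s t : nat) (I : nat -> {set T} -> {set T} -> Prop) :
  (forall n M K W, I n M K -> W \in F -> W \subset M -> n = 0 /\ s <= #|W|) ->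
  (forall n M K S, I n M K -> legal_move m M K S ->
     exists2 R, legal_move b (M :|: S) K R & I n.-1 (M :|: S) (K :|: R)) ->
  (if p0 == Maker then I t set0 set0
   else exists2 R, legal_move b set0 set0 R & I t set0 R) ->
  breaker_can_restrict F m b p0 s t.
Proof.
move=> Iwin Istep I0.
pose J p n M K := if p == Maker then I n M K
  else exists2 R, legal_move b M K R & I n M (K :|: R).
pose tau := choose_move b (fun h R =>
  I (t - maker_moves h) (claimed Maker h) (claimed Breaker h :|: R)).
exists tau; first exact: choose_move_legal.
move=> sigma lsigma.
have inv : forall r, let h := rounds F p0 sigma tau r in
    exists2 p, J p (t - maker_moves h) (claimed Maker h) (claimed Breaker h)
    & (maker_moves h <= r) && (maker_won F h || (maker_moves h == r)).
  apply: play_inv.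
    move: I0; rewrite /J; case: (p0 == Maker) => //.
    by case=> R lR IR; exists R; rewrite ?set0U.
  move=> h M K n _; split; rewrite /J /=.
    by move=> InMK; apply: Istep => //; exact: legalP.
  exact: choose_moveP.
have Jwin p n M K W : J p n M K -> W \in F -> W \subset M -> n = 0 /\ s <= #|W|.
  by rewrite /J; case: (p == Maker) => [|[R _]]; exact: Iwin.
split=> [r rt|r W WF Ws].
  have [p Jp /andP[cnt _]] := inv r; apply/negP => won.
  have /exists_inP[W WF WM] := won.
  have [n0 _] := Jwin _ _ _ _ _ Jp WF WM.
  by lia.
have [p Jp _] := inv r; apply: contraL Ws => WM; rewrite -leqNgt.
by have [] := Jwin _ _ _ _ _ Jp WF WM.
Qed.

(** Dually, at Breaker's turns every legal reply must restore [I]. A step is demanded only while no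
    winning set is owned, because play stops at a win. *)
Lemma maker_can_occupy_inv (T : finType) (F : {set {set T}}) (m b : nat)
    (p0 : player) (s t : nat) (I : nat -> {set T} -> {set T} -> Prop) :
  (forall n M K W, I n M K -> W \in F -> W \subset M -> #|W| = s) ->
  (forall M K, I 0 M K -> exists2 W, W \in F & W \subset M) ->
  (forall n M K, I n.+1 M K -> (forall W, W \in F -> ~~ (W \subset M)) ->
     exists2 S, legal_move m M K S &
       forall R, legal_move b (M :|: S) K R -> I n (M :|: S) (K :|: R)) ->
  (if p0 == Maker then I t set0 set0
   else forall R, legal_move b set0 set0 R -> I t set0 R) ->
  maker_can_occupy F m b p0 s t.
Proof.
move=> Iwin I0win Istep I0.
pose J p n M K := if p == Maker then I n M K
  else forall R, legal_move b M K R -> I n M (K :|: R).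
pose sigma := choose_move m (fun h S =>
  J Breaker (t - maker_moves h).-1 (claimed Maker h :|: S) (claimed Breaker h)).
exists sigma; first exact: choose_move_legal.
move=> tau ltau.
have inv : forall r, let h := rounds F p0 sigma tau r in
    exists2 p, J p (t - maker_moves h) (claimed Maker h) (claimed Breaker h)
    & (maker_moves h <= r) && (maker_won F h || (maker_moves h == r)).
  apply: play_inv.
    move: I0; rewrite /J; case: (p0 == Maker) => // I0 R lR.
    by rewrite set0U; exact: I0.
  move=> h M K n nwon; split; last first.
    by rewrite /J /= => IB; apply: IB; exact: legalP.
  move: (nwon); rewrite /maker_won negb_exists_in => /forall_inP nW.
  move=> IM; apply: (@choose_moveP _ _ (fun h S => J Breaker
    (t - maker_moves h).-1 (claimed Maker h :|: S) (claimed Breaker h))).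
  move: IM; rewrite /n; case: (t - _) => [|k] IM.
    by have [W WF] := I0win _ _ IM; rewrite (negPf (nW _ WF)).
  by have [S lS IS] := Istep _ _ _ IM nW; exists S.
have [p Jp /andP[_ won]] := inv t; set h := rounds _ _ _ _ _ in Jp won *.
have [n [K In]] : exists n K, I n (claimed Maker h) K /\ (maker_won F h || (n == 0)).
  move: Jp won; rewrite /J; case: (p == Maker) => Jp won.
    exists (t - maker_moves h), (claimed Breaker h); split=> //.
    by case/orP: won => [->//|/eqP->]; rewrite subnn eqxx orbT.
  (* With Breaker to move, his empty reply yields a position satisfying [I] without changing Maker's
     set. *)
  exists (t - maker_moves h), (claimed Breaker h :|: set0); split.
    by apply: Jp; exact: legal_move0.
  by case/orP: won => [->//|/eqP->]; rewrite subnn eqxx orbT.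
case: In => In /orP[/exists_inP[W WF WM]|/eqP n0].
  by exists W; split=> //; exact: Iwin In WF WM.
rewrite n0 in In; have [W WF WM] := I0win _ _ In.
by exists W; split=> //; exact: Iwin In WF WM.
Qed.

(** * From elements to blocks *)

(* A gadget stands for a hypergraph in which each vertex is blown up to a block
   of [m] elements, and each edge [e] to [b] winning sets: the blocks of its core
   together with one of [b] disjoint tails of [c e] elements each. *)
Record gadget := Gadget {
  vertex : finType;
  edge : finType;
  core : edge -> {set vertex} }.

(** Every tail is given room for [m] elements, so that the type does not depend on the tail
    lengths. *)
Definition elt (m b : nat) (G : gadget) : finType :=
  ((vertex G * 'I_m) + (edge G * 'I_b * 'I_m))%type.

Definition block m b (G : gadget) (v : vertex G) : {set elt m b G} :=
  [set inl (v, i) | i : 'I_m].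

Definition tail m b (G : gadget) (c : edge G -> nat) (e : edge G) (j : 'I_b) :
    {set elt m b G} :=
  [set inr (e, j, i) | i : 'I_m & i < c e].

Definition winning m b (G : gadget) (c : edge G -> nat) (e : edge G) (j : 'I_b) :
    {set elt m b G} :=
  \bigcup_(v in core e) block m b v :|: tail m c e j.

Definition winning_sets m b (G : gadget) (c : edge G -> nat) :
    {set {set elt m b G}} :=
  [set winning m c x.1 x.2 | x : edge G * 'I_b].

Lemma inl_block m b (G : gadget) (v w : vertex G) i :
  ((inl (w, i) : elt m b G) \in block m b v) = (w == v).
Proof.
apply/imsetP/eqP => [[j _ [-> //]]|->]; by exists i.
Qed.

Lemma inr_block m b (G : gadget) (v : vertex G) x :
  ((inr x : elt m b G) \in block m b v) = false.
Proof. by apply/imsetP => -[]. Qed.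

Lemma inr_tail m b (G : gadget) (c : edge G -> nat) e j e' j' i :
  ((inr (e', j', i) : elt m b G) \in tail m c e j) = [&& e' == e, j' == j & i < c e].
Proof.
apply/imsetP/and3P => [[k]|[/eqP-> /eqP-> ic]]; last by exists i; rewrite // inE.
by rewrite inE => kc [-> -> ->].
Qed.

Lemma inl_tail m b (G : gadget) (c : edge G -> nat) e j x :
  ((inl x : elt m b G) \in tail m c e j) = false.
Proof. by apply/imsetP => -[]. Qed.

Lemma blockP m b (G : gadget) (v : vertex G) (x : elt m b G) :
  reflect (exists i, x = inl (v, i)) (x \in block m b v).
Proof. by apply: (iffP imsetP) => [[i _ ->]|[i ->]]; exists i. Qed.

Lemma card_block m b (G : gadget) (v : vertex G) : #|block m b v| = m.
Proof. by rewrite card_imset ?card_ord // => i j [->]. Qed.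

Lemma tail_neq0 m b (G : gadget) (c : edge G -> nat) e (j : 'I_b) :
  0 < m -> 0 < c e -> exists x, x \in tail m c e j.
Proof. by move=> m0 c0; exists (inr (e, j, Ordinal m0)); rewrite inr_tail !eqxx. Qed.

Lemma card_tail m b (G : gadget) (c : edge G -> nat) e (j : 'I_b) :
  c e <= m -> #|tail m c e j| = c e.
Proof.
move=> cm; rewrite card_imset => [|i k [->] //].
rewrite -sum1_card (eq_bigl (fun i : 'I_m => i < c e)) => [|i]; last by rewrite inE.
by rewrite (big_ord_narrow cm) sum1_card card_ord.
Qed.

Lemma card_winning m b (G : gadget) (c : edge G -> nat) e (j : 'I_b) :
  c e <= m -> #|winning m c e j| = m * #|core e| + c e.
Proof.
move=> cm; rewrite cardsU card_tail //.
have -> : #|(\bigcup_(v in core e) block m b v) :&: tail m c e j| = 0.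
  apply/eqP; rewrite cards_eq0; apply/eqP/setP => x; rewrite !inE.
  by apply/negP => /andP[/bigcupP[v _ /blockP[i ->]]]; rewrite inl_tail.
rewrite subn0; congr (_ + _).
have -> : \bigcup_(v in core e) block m b v =
    [set (inl x : elt m b G) | x in setX (core e) [set: 'I_m]].
  apply/setP => x; apply/bigcupP/imsetP => [[v ve /blockP[i ->]]|[[v i]]].
    by exists (v, i); rewrite // !inE ve.
  by rewrite !inE andbT => /= ve ->; exists v; rewrite // inl_block.
by rewrite card_imset ?cardsX ?cardsT ?card_ord 1?mulnC // => x y [].
Qed.

(** * Breaker's side: from the game on blocks to the game on elements *)

(* The game on blocks: Maker owns [O]; Breaker has hit the blocks of [Z] and all
   tails of the edges of [N].  Maker claims at most one block per round, and
   Breaker answers by hitting up to [b] blocks, or all tails of a single edge.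
   When [r] moves of Maker remain, the edges in [guard r] must not be won; the
   clock stops at [0], where the remaining guard has to be kept forever. *)
Definition hold_inv (b : nat) (G : gadget) (guard : nat -> edge G -> bool)
    (I : nat -> {set vertex G} -> {set vertex G} -> {set edge G} -> Prop) :=
  forall r O Z N, I r O Z N ->
  [/\ forall e, guard r.-1 e -> core e \subset O -> e \in N,
      forall (Z1 : {set vertex G}) (N1 : {set edge G}), Z \subset Z1 -> N \subset N1 -> [disjoint O & Z1] ->
        I r.-1 O Z1 N1
    & forall v, v \notin O -> v \notin Z -> exists (Z' : {set vertex G}) (N' : {set edge G}),
        [/\ [disjoint Z' & v |: O], #|Z'| + b * #|N'| <= b
          & I r.-1 (v |: O) (Z :|: Z') (N :|: N')]].

(** The union of all invariants, hence the largest one: a coinductive predicate given by its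
    postfixed points. *)
Definition holds b (G : gadget) guard r O Z N :=
  exists2 I, @hold_inv b G guard I & I r O Z N.

Lemma hold_inv_holds b G guard : hold_inv b guard (@holds b G guard).
Proof.
move=> r O Z N [I HI IrOZN]; have [live pass step] := HI _ _ _ _ IrOZN; split=> //.
  by move=> Z1 N1 sZ sN dO; exists I => //; exact: pass.
move=> v vO vZ; have [Z' [N' [dis card I']]] := step v vO vZ.
by exists Z', N'; split=> //; exists I.
Qed.

(* A tail touched by Maker is harmless if Breaker hit it, or hit its core. *)
Definition clean m b (G : gadget) (c : edge G -> nat) (guard : edge G -> bool)
    (O Z : {set vertex G}) (N : {set edge G}) (M K : {set elt m b G}) : Prop :=
  let dead e := exists2 v, v \in core e & v \in Z in
  [/\ [disjoint M & K],
      forall v, v \in O -> block m b v \subset M,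
      forall v, v \in Z -> ~~ [disjoint block m b v & K],
      forall v, v \notin O -> v \notin Z -> [disjoint block m b v & M]
    & forall e j, guard e -> dead e \/ ~~ [disjoint tail m c e j & K] \/
        (e \notin N /\ [disjoint tail m c e j & M])].

(** Each alternative in [clean] yields an element of the winning set that Maker lacks: one of
    Breaker's in a core block or in the tail, or any element of the untouched, nonempty tail. *)
Lemma clean_not_won m b (G : gadget) (c : edge G -> nat) guard O Z N M K e (j : 'I_b) :
  0 < m -> 0 < c e -> @clean m b G c guard O Z N M K -> guard e ->
  ~~ (winning m c e j \subset M).
Proof.
move=> m0 c0 [dMK HO HZ HV HE] ge; apply/negP; rewrite subUset => /andP[sB sT].
have [x xt] := tail_neq0 j m0 c0.
have [[v ve vZ]|[|[_ dT]]] := HE e j ge.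
- apply/negP: (HZ v vZ); rewrite negbK.
  apply: disjointWl dMK; apply: subset_trans sB; exact: bigcup_sup ve.
- by apply/negP; rewrite negbK; exact: disjointWl sT dMK.
- by have := disjointFr dT xt; rewrite (subsetP sT).
Qed.

Lemma not_disjointP (T : finType) (A B : {set T}) :
  reflect (exists2 x, x \in A & x \in B) (~~ [disjoint A & B]).
Proof.
rewrite -setI_eq0; apply: (iffP (set0Pn _)) => [[x]|[x xA xB]].
  by rewrite inE => /andP[]; exists x.
by exists x; rewrite inE xA.
Qed.

Lemma disjointP (T : finType) (A B : {set T}) :
  reflect (forall x, x \in A -> x \notin B) [disjoint A & B].
Proof. by rewrite disjoints_subset; apply: (iffP subsetP) => H x /H; rewrite inE. Qed.

(** Breaker takes one element in each block of [Z'] and one in each of the [b] tails of every edge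
    of [N'], which costs at most [#|Z'| + b * #|N'|]. Elements he already has count as hits. *)
Lemma clean_block_step m b (G : gadget) (c : edge G -> nat) guard O Z N M K v
    (Z' : {set vertex G}) (N' : {set edge G}) :
  0 < m -> (forall e, 0 < c e) ->
  @clean m b G c guard O Z N M K -> v \notin O -> v \notin Z ->
  [disjoint block m b v & M :|: K] ->
  [disjoint Z' & v |: O] -> #|Z'| + b * #|N'| <= b ->
  exists2 R, legal_move b (M :|: block m b v) K R
    & clean c guard (v |: O) (Z :|: Z') (N :|: N') (M :|: block m b v) (K :|: R).
Proof.
move=> m0 c0 [dMK HO HZ HV HE] vO vZ dv dZ' card.
pose pick_block (z : vertex G) : elt m b G := inl (z, Ordinal m0).
pose pick_tail (x : edge G * 'I_b) : elt m b G := inr (x.1, x.2, Ordinal m0).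
pose R0 := (pick_block @: Z') :|: (pick_tail @: setX N' [set: 'I_b]).
pose R := R0 :\: (M :|: block m b v :|: K).
have dvM : [disjoint block m b v & M] by apply: disjointWr dv; exact: subsetUl.
have dvK : [disjoint block m b v & K] by apply: disjointWr dv; exact: subsetUr.
have sub0 x : x \in R0 -> x \notin M -> x \notin block m b v -> x \in K :|: R.
  by move=> x0 xM xv; rewrite inE [x \in R]inE x0 andbT !in_setU (negPf xM) (negPf xv) /= orbN.
exists R.
  rewrite /legal_move; apply/andP; split.
    apply: leq_trans (subset_leq_card (subsetDl _ _)) _.
    apply: leq_trans (leq_card_setU _ _) _; apply: leq_trans card.
    apply: leq_add; first exact: leq_imset_card.
    apply: leq_trans (leq_imset_card _ _) _.
    by rewrite cardsX cardsT card_ord mulnC.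
  by rewrite disjoints_subset subsetDr.
have dMK' : [disjoint M :|: block m b v & K :|: R].
  rewrite disjoints_subset; apply/subsetP => x; rewrite !inE => xMv.
  rewrite xMv /= orbF; case/orP: xMv => [xM|xv]; first by rewrite (disjointFr dMK xM).
  by rewrite (disjointFr dvK xv).
split=> //.
- move=> w /setU1P[->|wO]; first exact: subsetUr.
  by apply: subset_trans (HO _ wO) (subsetUl _ _).
- move=> z zZZ; have [zZ|zZ] := boolP (z \in Z).
    by apply: contra (HZ z zZ); apply: disjointWr; exact: subsetUl.
  move: zZZ; rewrite inE (negPf zZ) /= => zZ'.
  have /negbT := disjointFr dZ' zZ'; rewrite !inE negb_or => /andP[zv zO].
  apply/not_disjointP; exists (pick_block z); first by rewrite inl_block.
  apply: sub0; rewrite ?inl_block //.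
    by rewrite inE imset_f.
  by rewrite (disjointFr (HV z zO zZ)) // inl_block.
- move=> w; rewrite !inE !negb_or => /andP[wv wO] /andP[wZ _].
  apply/disjointP => x xw; rewrite inE (disjointFr (HV w wO wZ) xw) /=.
  by case/blockP: xw => i ->; rewrite inl_block.
- move=> e j ge; have [[z ze zZ]|[hit|[eN dT]]] := HE e j ge.
  + by left; exists z; rewrite // inE zZ.
  + by right; left; apply: contra hit; apply: disjointWr; exact: subsetUl.
  have [eN'|eN'] := boolP (e \in N'); last first.
    right; right; split; first by rewrite !inE (negPf eN).
    apply/disjointP => x xt; rewrite inE (disjointFr dT xt) /=.
    by apply/negP => /blockP[i xE]; rewrite xE inl_tail in xt.
  right; left; apply/not_disjointP; exists (pick_tail (e, j)).
    by rewrite inr_tail !eqxx c0.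
  apply: sub0; rewrite ?inr_block //.
    by rewrite inE; apply/orP; right; apply: imset_f; rewrite !inE eN'.
  by rewrite (disjointFr dT) // inr_tail !eqxx c0.
Qed.

(* If Maker does not claim exactly one block, she completes none, so Breaker can
   spoil whatever she touched at the price of one element for each of hers. *)
Lemma clean_scatter_step m b (G : gadget) (c : edge G -> nat) guard O Z N M K S :
  0 < m -> m <= b -> (forall e, 0 < c e) ->
  @clean m b G c guard O Z N M K ->
  (forall e, guard e -> core e \subset O -> e \in N) ->
  legal_move m M K S -> (forall v, S != block m b v) ->
  exists (R : {set elt m b G}) (Z' : {set vertex G}),
    [/\ legal_move b (M :|: S) K R, Z \subset Z', [disjoint O & Z']
    & clean c guard O Z' N (M :|: S) (K :|: R)].
Proof.
move=> m0 mb c0 [dMK HO HZ HV HE] live /andP[cS dS] nblock.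
have dSM : [disjoint S & M] by apply: disjointWr dS; exact: subsetUl.
have dSK : [disjoint S & K] by apply: disjointWr dS; exact: subsetUr.
(* Where Breaker answers [x]: in its block or its tail, or, if Maker has the whole tail, in the core
   of the edge. *)
pose zone (x : elt m b G) : {set elt m b G} := match x with
  | inl (v, _) => block m b v
  | inr (e, j, _) => let A := tail m c e j :\: (M :|: S) in
      if A == set0 then \bigcup_(v in core e) block m b v else A
  end.
(* The default [x] is Maker's own, so it drops out of [R]. *)
pose ans x := odflt x [pick y in zone x :\: (M :|: S)].
pose R := (ans @: S) :\: (M :|: S :|: K).
have ansP x y : x \in S -> y \in zone x -> y \notin M :|: S ->
    exists2 z, z \in zone x & z \in K :|: R.
  move=> xS yz yMS; have : ans x \in zone x :\: (M :|: S).
    by rewrite /ans; case: pickP => //= /(_ y); rewrite !inE in yMS *; rewrite yMS yz.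
  rewrite inE => /andP[aMS az]; exists (ans x) => //.
  have aS : ans x \in ans @: S by exact: imset_f.
  rewrite 2!inE aS andbT [_ \in M :|: S :|: K]inE negb_or aMS /=.
  by rewrite orbN.
have nfull v : ~~ (block m b v \subset S).
  apply/negP => sv; have := nblock v; rewrite eq_sym eqEcard sv /=.
  by rewrite card_block cS.
have dMK' : [disjoint M :|: S & K :|: R].
  rewrite disjoints_subset; apply/subsetP => x xMS; rewrite !inE.
  move: xMS; rewrite inE => xMS; rewrite xMS /= orbF.
  by case/orP: xMS => [/(disjointFr dMK)|/(disjointFr dSK)] ->.
pose Z' := [set v | ~~ [disjoint block m b v & K :|: R]].
have sZ : Z \subset Z'.
  apply/subsetP => v /HZ; rewrite inE; apply: contra; apply: disjointWr.
  exact: subsetUl.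
have untouched v : v \notin O -> v \notin Z' -> [disjoint block m b v & M].
  by move=> vO vZ; apply: HV => //; apply: contra vZ; exact: (subsetP sZ).
exists R, Z'; split=> //.
- apply/andP; split; last by rewrite disjoints_subset subsetDr.
  apply: leq_trans (subset_leq_card (subsetDl _ _)) _.
  by apply: leq_trans (leq_imset_card _ _) _; apply: leq_trans cS mb.
- apply/disjointP => v /HO vM; rewrite inE negbK.
  by apply: disjointWl dMK'; apply: subset_trans vM (subsetUl _ _).
split=> //.
- by move=> v /HO vM; apply: subset_trans vM (subsetUl _ _).
- by move=> v; rewrite inE.
- move=> v vO vZ; have dvM := untouched v vO vZ.
  apply/disjointP => x xv; rewrite inE (disjointFr dvM xv) /=; apply/negP => xS.
  have /subsetPn[y yv yS] := nfull v; move/negP: vZ; apply; rewrite inE.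
  case/blockP: (xv) => i xE.
  have [||z zv zK] := ansP x y xS.
  + by rewrite xE.
  + by rewrite inE (disjointFr dvM yv).
  by apply/not_disjointP; exists z => //; rewrite xE in zv.
- move=> e j ge; have [[z ze zZ]|[hit|[eN dT]]] := HE e j ge.
  + by left; exists z; rewrite // (subsetP sZ).
  + by right; left; apply: contra hit; apply: disjointWr; exact: subsetUl.
  have [dTS|/not_disjointP[x xT xS]] := boolP [disjoint tail m c e j & S].
    right; right; split=> //; apply/disjointP => x xT.
    by rewrite inE (disjointFr dT xT) (disjointFr dTS xT).
  have zx : zone x = let A := tail m c e j :\: (M :|: S) in
      if A == set0 then \bigcup_(v in core e) block m b v else A.
    case: x xT {xS} => [x|[[e' j'] i]]; first by rewrite inl_tail.
    by rewrite inr_tail => /and3P[/eqP-> /eqP-> _].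
  move: zx => /=; case: ifPn => [A0|/set0Pn[y yA]] zx; last first.
    right; left; have [||z zz zK] := ansP x y xS.
    + by rewrite zx.
    + by move: yA; rewrite inE => /andP[].
    apply/not_disjointP; exists z => //.
    by move: zz; rewrite zx inE => /andP[].
  (* Maker has the whole tail. By [live] some core block is missing from [O]; unless it is already
     hit, [S] does not contain it entirely, so the core has room for an answer. *)
  left; have /subsetPn[v ve vO] : ~~ (core e \subset O).
    by apply: contra eN; exact: live.
  have [vZ|vZ] := boolP (v \in Z'); first by exists v.
  have /subsetPn[y yv yS] := nfull v.
  have [||z zz zK] := ansP x y xS.
  + by rewrite zx; apply/bigcupP; exists v.
  + by rewrite inE (disjointFr (untouched v vO vZ) yv).
  move: zz; rewrite zx => /bigcupP[w we zw]; exists w => //.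
  by rewrite inE; apply/not_disjointP; exists z.
Qed.

Lemma clean_guard m b (G : gadget) (c : edge G -> nat) (g g' : edge G -> bool)
    O Z N (M K : {set elt m b G}) :
  (forall e, g' e -> g e) -> clean c g O Z N M K -> clean c g' O Z N M K.
Proof. by move=> gg [? ? ? ? HE]; split=> // e j /gg; exact: HE. Qed.

(** All edges are guarded while the clock runs, and those leaving the guard at 0 give winning sets
    of size at least [s]. Moving first, Breaker spends his opening on one element of the block
    [v]. *)
Lemma holds_breaker_can_restrict m b (G : gadget) (c : edge G -> nat)
    (guard : nat -> edge G -> bool) (s t : nat) (p0 : player) :
  0 < m -> m <= b -> (forall e, 0 < c e <= m) ->
  (forall r e, guard r.-1 e -> guard r e) ->
  (forall r e, 0 < r -> guard r e) ->
  (forall e, ~~ guard 0 e -> s <= m * #|core e| + c e) ->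
  (if p0 == Maker then holds b guard t set0 set0 set0
   else exists v, holds b guard t set0 [set v] set0) ->
  breaker_can_restrict (winning_sets m b c) m b p0 s t.
Proof.
move=> m0 mb cP gdec gpos g0 H0.
have c0 e : 0 < c e by case/andP: (cP e).
pose I n (M K : {set elt m b G}) :=
  exists O Z N, holds b guard n O Z N /\ clean c (guard n) O Z N M K.
apply: (@breaker_can_restrict_inv _ _ _ _ _ _ _ I).
- move=> n M K W [O [Z [N [_ cl]]]] /imsetP[[e j] _ -> /= WM].
  have nge : ~~ guard n e.
    by apply: contraL WM => ge; exact: clean_not_won cl ge.
  have n0 : n = 0 by case: n {cl} nge => // n; rewrite gpos.
  by split=> //; rewrite card_winning ?g0 -?n0 //; case/andP: (cP e).
- move=> n M K S [O [Z [N [hold cl]]]] lS.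
  have [live pass step] := hold_inv_holds hold.
  have cl' := clean_guard (@gdec n) cl.
  have [/existsP[v /eqP SE]|] := boolP [exists v, S == block m b v]; last first.
    (* A move other than a whole block is a pass in the game on blocks, possibly with more blocks
       hit by Breaker. *)
    rewrite negb_exists => /forallP nb.
    have [R [Z' [lR sZ dO cR]]] := clean_scatter_step m0 mb c0 cl' live lS nb.
    by exists R => //; exists O, Z', N; split=> //; exact: pass.
  subst S; case/andP: lS => _ dS.
  have [dMK HO HZ _ _] := cl.
  have xb : inl (v, Ordinal m0) \in block m b v by rewrite inl_block.
  have vO : v \notin O.
    apply/negP => /HO /subsetP/(_ _ xb) xM.
    by have := disjointFr dS xb; rewrite inE xM.
  have vZ : v \notin Z.
    apply/negP => /HZ/not_disjointP[x xv xK].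
    by have := disjointFr dS xv; rewrite inE xK orbT.
  have [Z' [N' [dZ' card hold']]] := step v vO vZ.
  have [R lR cR] := clean_block_step m0 c0 cl' vO vZ dS dZ' card.
  by exists R => //; exists (v |: O), (Z :|: Z'), (N :|: N').
case: (p0 == Maker) H0 => [H0|[v H0]].
  exists set0, set0, set0; split=> //; split=> [|v|v|v _ _|e j _].
  - by rewrite disjoints_subset sub0set.
  - by rewrite inE.
  - by rewrite inE.
  - by rewrite disjoint_sym disjoints_subset sub0set.
  right; right; rewrite inE; split=> //.
  by rewrite disjoint_sym disjoints_subset sub0set.
exists [set inl (v, Ordinal m0)].
  rewrite /legal_move cards1 (leq_trans m0 mb) setU0 disjoint_sym.
  by rewrite disjoints_subset sub0set.
exists set0, [set v], set0; split=> //; split=> [|w|w|w _ _|e j _].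
- by rewrite disjoints_subset sub0set.
- by rewrite inE.
- rewrite inE => /eqP->; apply/not_disjointP; exists (inl (v, Ordinal m0)).
    by rewrite inl_block.
  by rewrite inE.
- by rewrite disjoint_sym disjoints_subset sub0set.
right; right; rewrite inE; split=> //.
by rewrite disjoint_sym disjoints_subset sub0set.
Qed.

(** * Maker's side: forcing sequences *)

(* Two live edges have [2 * b] open tails, which is more than Breaker can hit; a
   single one forces him to spend his whole move on its [b] tails. *)
Fixpoint forces (b : nat) (G : gadget) (U : {set vertex G}) (n : nat)
    (O Z : {set vertex G}) (N : {set edge G}) : Prop :=
  if n is n'.+1 then
    exists v, [/\ v \in U, v \notin O, v \notin Z &
      let O' := v |: O in
      let live e := (core e \subset O') && (e \notin N) in
      [\/ 0 < n' /\ (exists e1 e2, [/\ e1 != e2, live e1 & live e2]),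
          (exists2 e, live e & forces b U n' O' Z (e |: N))
        | forall Y : {set vertex G + edge G}, #|Y| <= b ->
            forces b U n' O' (Z :|: inl @^-1: Y) (N :|: inr @^-1: Y)]]
  else False.

(** Completing a core and claiming a tail are separate moves. *)
Lemma forces_gt1 b (G : gadget) (U : {set vertex G}) n O Z N :
  forces b U n O Z N -> 1 < n.
Proof.
elim: n O Z N => //= n IH O Z N [v [_ _ _ [[] //|[e _] /IH|/(_ set0)]]].
  by move/ltnW.
by rewrite cards0 => /(_ isT) /IH /ltnW.
Qed.

(** Here [Z] and [N] bound from above what Breaker has touched, whereas in [clean] they record hits
    he is sure to have. *)
Definition fresh m b (G : gadget) (c : edge G -> nat) (U O Z : {set vertex G})
    (N : {set edge G}) (M K : {set elt m b G}) : Prop :=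
  [/\ M = \bigcup_(v in O) block m b v, O \subset U, [disjoint M & K],
      forall v, v \notin Z -> [disjoint block m b v & K]
    & forall e j, e \notin N -> [disjoint tail m c e j & K]].

Lemma winning_sub_blocks m b (G : gadget) (c : edge G -> nat) (O : {set vertex G}) e0 j0 e (j : 'I_b) :
  0 < m ->
  winning m c e j \subset \bigcup_(v in O) block m b v :|: tail m c e0 j0 ->
  core e \subset O.
Proof.
move=> m0 sub; apply/subsetP => v ve.
have /(subsetP sub) : inl (v, Ordinal m0) \in winning m c e j.
  by rewrite inE; apply/orP; left; apply/bigcupP; exists v; rewrite ?inl_block.
rewrite inE inl_tail orbF => /bigcupP[w wO]; by rewrite inl_block => /eqP->.
Qed.

Lemma winning_nsub_blocks m b (G : gadget) (c : edge G -> nat) (O : {set vertex G}) e (j : 'I_b) :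
  0 < m -> 0 < c e -> ~~ (winning m c e j \subset \bigcup_(v in O) block m b v).
Proof.
move=> m0 c0; apply/subsetPn; exists (inr (e, j, Ordinal m0)).
  by rewrite inE inr_tail !eqxx c0 orbT.
by apply/bigcupP => -[v _]; rewrite inr_block.
Qed.

(** The [b] tails of [e] are disjoint, so at most [b] elements meeting all of them meet each once
    and leave none elsewhere. *)
Lemma tails_hit m b (G : gadget) (c : edge G -> nat) e (R : {set elt m b G}) :
  #|R| <= b ->
  (exists j : 'I_b, [disjoint tail m c e j & R]) \/
  (forall x, x \in R -> exists j, x \in tail m c e j).
Proof.
move=> cR; have [/existsP|] := boolP [exists j, [disjoint tail m c e j & R]].
  by left.
rewrite negb_exists => /forallP hit; right.
pose R' := R :&: \bigcup_j tail m c e j.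
pose f (x : elt m b G) := if x is inr (_, j, _) then Some j else None.
have /subset_leq_card : Some @: [set: 'I_b] \subset f @: R'.
  apply/subsetP => _ /imsetP[j _ ->].
  have /not_disjointP[x xt xR] := hit j; apply/imsetP; exists x.
    by rewrite inE xR; apply/bigcupP; exists j.
  by case/imsetP: xt => i _ ->.
rewrite card_imset ?cardsT ?card_ord => [bR'|i j [] //].
have RR' : R' == R.
  rewrite eqEcard subsetIl; apply: leq_trans cR _.
  exact: leq_trans bR' (leq_imset_card _ _).
by move=> x; rewrite -(eqP RR') inE => /andP[_ /bigcupP[j _ xj]]; exists j.
Qed.

Lemma tail_inj m b (G : gadget) (c : edge G -> nat) e j e' j' (x : elt m b G) :
  x \in tail m c e j -> x \in tail m c e' j' -> e = e' /\ j = j'.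
Proof.
by case/imsetP => i _ ->; rewrite inr_tail => /and3P[/eqP-> /eqP->].
Qed.

Definition threatens m b (G : gadget) (c : edge G -> nat) (U : {set vertex G})
    (M K : {set elt m b G}) : Prop :=
  exists (O : {set vertex G}) e j,
    [/\ M = \bigcup_(v in O) block m b v, O \subset U, core e \subset O
      & [disjoint tail m c e j & K]].

(** By [tails_hit], a reply leaves an open tail at a live edge unless all of it goes into the tails
    of that edge. So it cannot close two live edges, and closing one touches nothing else. *)
Lemma fresh_step m b (G : gadget) (c : edge G -> nat) U n O Z N (M K : {set elt m b G}) :
  0 < m -> 0 < b ->
  forces b U n.+1 O Z N -> fresh c U O Z N M K ->
  exists2 S, legal_move m M K S & forall R, legal_move b (M :|: S) K R ->
    (exists O' Z' N', forces b U n O' Z' N' /\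
        fresh c U O' Z' N' (M :|: S) (K :|: R)) \/
    (0 < n /\ threatens c U (M :|: S) (K :|: R)).
Proof.
move=> m0 b0 /= [v [vU vO vZ Hv]] [ME OU dMK dZ dN].
exists (block m b v).
  rewrite /legal_move card_block leqnn; apply/disjointP => x xv; rewrite inE.
  rewrite (disjointFr (dZ v vZ) xv) orbF ME; apply/bigcupP => -[w wO].
  case/blockP: xv => i ->; rewrite inl_block => /eqP vw.
  by rewrite vw wO in vO.
move=> R /andP[cR dR].
set O' := v |: O in Hv; set M' := M :|: block m b v.
have M'E : M' = \bigcup_(v in O') block m b v.
  by rewrite big_setU1 //= -ME setUC.
have O'U : O' \subset U by rewrite subUset sub1set vU.
have dRM' : [disjoint R & M'] by apply: disjointWr dR; exact: subsetUl.
have dM'K : [disjoint M' & K :|: R].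
  apply/disjointP => x xM; rewrite inE (disjointFl dRM' xM) orbF.
  move: xM; rewrite inE => /orP[xM|xv]; first by rewrite (disjointFr dMK).
  by rewrite (disjointFr (dZ v vZ) xv).
have threat e j : core e \subset O' -> e \notin N ->
    [disjoint tail m c e j & R] -> threatens c U M' (K :|: R).
  move=> eO eN eR; exists O', e, j; split=> //.
  apply/disjointP => x xt; rewrite inE (disjointFr eR xt) orbF.
  by rewrite (disjointFr (dN e j eN) xt).
case: Hv => [[n0 [e1 [e2 [e12 /andP[l1 N1] /andP[l2 N2]]]]]|[e /andP[le Ne] fe]|fY].
- right; split=> //; have [[j dj]|all1] := tails_hit c e1 cR.
    exact: threat dj.
  apply: (threat e2 (Ordinal b0)) => //; apply/disjointP => x xt; apply/negP.
  case/all1 => j /tail_inj/(_ xt)[e12' _].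
  by rewrite e12' eqxx in e12.
- have [[j dj]|alle] := tails_hit c e cR.
    by right; split; [exact: ltnW (forces_gt1 fe) | exact: threat dj].
  left; exists O', Z, (e |: N); split=> //; split=> //.
    move=> w wZ; apply/disjointP => x xw; rewrite inE (disjointFr (dZ w wZ) xw) /=.
    apply/negP => /alle[j]; case/blockP: xw => i ->; by rewrite inl_tail.
  move=> e' j'; rewrite !inE negb_or => /andP[ee eN'].
  apply/disjointP => x xt; rewrite inE (disjointFr (dN e' j' eN') xt) /=.
  apply/negP => /alle[j] /tail_inj/(_ xt)[e1 _]; by rewrite e1 eqxx in ee.
left; pose touch (x : elt m b G) : vertex G + edge G :=
  match x with inl (w, _) => inl w | inr (e, _, _) => inr e end.
exists O', (Z :|: inl @^-1: (touch @: R)), (N :|: inr @^-1: (touch @: R)).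
split; first by apply: fY; exact: leq_trans (leq_imset_card _ _) cR.
split=> //.
  move=> w; rewrite !inE negb_or => /andP[wZ wR].
  apply/disjointP => x xw; rewrite inE (disjointFr (dZ w wZ) xw) /=.
  apply: contra wR => xR; apply/imsetP; exists x => //.
  by case/blockP: xw => i ->.
move=> e j; rewrite !inE negb_or => /andP[eN eR].
apply/disjointP => x xt; rewrite inE (disjointFr (dN e j eN) xt) /=.
apply: contra eR => xR; apply/imsetP; exists x => //.
by case/imsetP: xt => i _ ->.
Qed.

(** Maker claims only blocks of [U] and a final tail, so any winning set she completes, intended or
    not, has size [s]. The invariant has three stages: a forcing position, an open threat, and a
    completed tail. *)
Lemma forces_maker_can_occupy m b (G : gadget) (c : edge G -> nat)
    (s t : nat) (p0 : player) :
  let good (U : {set vertex G}) :=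
    forall e, core e \subset U -> m * #|core e| + c e = s in
  0 < m -> 0 < b -> (forall e, 0 < c e <= m) ->
  (if p0 == Maker then exists2 U, good U & forces b U t set0 set0 set0
   else forall Y : {set vertex G + edge G}, #|Y| <= b ->
     exists2 U, good U & forces b U t set0 (inl @^-1: Y) (inr @^-1: Y)) ->
  maker_can_occupy (winning_sets m b c) m b p0 s t.
Proof.
move=> good m0 b0 cP H0.
have c0 e : 0 < c e by case/andP: (cP e).
have cm e : c e <= m by case/andP: (cP e).
pose I n (M K : {set elt m b G}) := exists2 U, good U &
  [\/ exists O Z N, forces b U n O Z N /\ fresh c U O Z N M K,
      0 < n /\ threatens c U M K
    | exists (O : {set vertex G}) e j,
        [/\ M = \bigcup_(v in O) block m b v :|: tail m c e j,
            O \subset U & core e \subset O]].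
apply: (@maker_can_occupy_inv _ _ _ _ _ _ _ I).
- move=> n M K W [U sU IM] /imsetP[[e j] _ -> /= WM]; rewrite card_winning //; apply: sU.
  case: IM => [[O [Z [N [_ [ME _ _ _ _]]]]]|[_ [O [e' [j' [ME _ _ _]]]]]|].
  + by move: WM; rewrite ME (negPf (winning_nsub_blocks _ _ _ _)).
  + by move: WM; rewrite ME (negPf (winning_nsub_blocks _ _ _ _)).
  move=> [O [e' [j' [ME OU _]]]]; apply: subset_trans OU.
  by move: WM; rewrite ME; exact: winning_sub_blocks.
- move=> M K [U _ [[O [Z [N [/forces_gt1 //]]]]|[] //|[O [e [j [-> OU eO]]]]]].
  exists (winning m c e j); first by apply/imsetP; exists (e, j).
  by rewrite setSU //; apply/bigcupsP => v ve; apply: bigcup_sup; exact: (subsetP eO).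
- move=> n M K [U sU [[O [Z [N [fo fr]]]]|[_ [O [e [j [ME OU eO dt]]]]]|H3]] nW.
  + have [S lS HS] := fresh_step m0 b0 fo fr; exists S => // R /HS[?|?].
      by exists U => //; constructor 1.
    by exists U => //; constructor 2.
  + exists (tail m c e j).
      rewrite /legal_move card_tail // cm; apply/disjointP => x xt.
      rewrite inE (disjointFr dt xt) orbF ME; apply/bigcupP => -[v _ /blockP[i xE]].
      by rewrite xE inl_tail in xt.
    by move=> R _; exists U => //; constructor 3; exists O, e, j; rewrite ME.
  case: H3 => [O [e [j [ME OU eO]]]].
  have WF : winning m c e j \in winning_sets m b c by apply/imsetP; exists (e, j).
  have /negP[] := nW _ WF.
  by rewrite ME setSU //; apply/bigcupsP => v ve; apply: bigcup_sup; exact: (subsetP eO).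
case: (p0 == Maker) H0 => [[U sU H0]|H0].
  exists U => //; constructor 1; exists set0, set0, set0; split=> //; split=> //.
  - by rewrite big_set0.
  - exact: sub0set.
  - by rewrite disjoints_subset sub0set.
  - by move=> v _; rewrite disjoint_sym disjoints_subset sub0set.
  - by move=> e j _; rewrite disjoint_sym disjoints_subset sub0set.
move=> R /andP[cR _].
pose touch (x : elt m b G) : vertex G + edge G :=
  match x with inl (w, _) => inl w | inr (e, _, _) => inr e end.
have [|U sU fU] := H0 (touch @: R); first exact: leq_trans (leq_imset_card _ _) cR.
exists U => //; constructor 1.
exists set0, (inl @^-1: (touch @: R)), (inr @^-1: (touch @: R)).
split=> //; split=> //.
- by rewrite big_set0.
- exact: sub0set.
- by rewrite disjoints_subset sub0set.
- move=> w; rewrite inE => wR; apply/disjointP => x xw.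
  apply: contra wR => xR; apply/imsetP; exists x => //.
  by case/blockP: xw => i ->.
move=> e j; rewrite inE => eR; apply/disjointP => x xt.
apply: contra eR => xR; apply/imsetP; exists x => //.
by case/imsetP: xt => i _ ->.
Qed.

(** * Paths *)

(* A path whose ends [0] and [L] are blocks that Maker already owns, or that
   Breaker has killed: they are vertices of [link L] but belong to no core. *)
Definition link (L : nat) : gadget :=
  @Gadget 'I_L.+1 'I_L (fun e => [set v : 'I_L.+1 | (0 < v < L) && (e <= v <= e.+1)]).

(* [ends] tells whether the two ends belong to Maker. *)
Definition owned L (ends : bool) (O : {set 'I_L.+1}) (v : 'I_L.+1) : bool :=
  if 0 < v < L then v \in O else ends.

Definition uncut L (Z : {set 'I_L.+1}) (N : {set 'I_L}) (i j : nat) : bool :=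
  [forall v : 'I_L.+1, (i < v < j) ==> (v \notin Z)] &&
  [forall e : 'I_L, (i <= e < j) ==> (e \notin N)].

Lemma uncutP L (Z : {set 'I_L.+1}) (N : {set 'I_L}) i j :
  reflect ((forall v : 'I_L.+1, i < v < j -> v \notin Z) /\
           (forall e : 'I_L, i <= e < j -> e \notin N))
          (uncut Z N i j).
Proof.
apply: (iffP andP) => -[HZ HN]; split.
- by move=> v vij; move/forallP/(_ v)/implyP: HZ; exact.
- by move=> e eij; move/forallP/(_ e)/implyP: HN; exact.
- by apply/forallP => v; apply/implyP; exact: HZ.
- by apply/forallP => e; apply/implyP; exact: HN.
Qed.

Lemma uncutS L (Z Z1 : {set 'I_L.+1}) (N N1 : {set 'I_L}) i j :
  Z \subset Z1 -> N \subset N1 -> uncut Z1 N1 i j -> uncut Z N i j.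
Proof.
move=> sZ sN /uncutP[HZ HN]; apply/uncutP; split=> [v /HZ|e /HN].
  by apply: contra; exact: (subsetP sZ).
by apply: contra; exact: (subsetP sN).
Qed.

Lemma uncut_sub L (Z : {set 'I_L.+1}) (N : {set 'I_L}) i j i' j' :
  i <= i' -> j' <= j -> uncut Z N i j -> uncut Z N i' j'.
Proof.
move=> ii jj /uncutP[HZ HN]; apply/uncutP; split=> [v vij|e eij].
  by apply: HZ; lia.
by apply: HN; lia.
Qed.

Lemma uncut_cat L (Z : {set 'I_L.+1}) (N : {set 'I_L}) i (v : 'I_L.+1) j :
  uncut Z N i v -> uncut Z N v j -> v \notin Z -> uncut Z N i j.
Proof.
move=> /uncutP[HZ HN] /uncutP[HZ' HN'] vZ; apply/uncutP; split=> [w wij|e eij].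
  case: (ltngtP w v) => [wv|vw|/ord_inj-> //]; [apply: HZ|apply: HZ']; lia.
by case: (ltnP e v) => ev; [apply: HN|apply: HN']; lia.
Qed.

Definition spread L (ends : bool) (d : nat) (O Z : {set 'I_L.+1}) (N : {set 'I_L}) :=
  forall i j : 'I_L.+1, i < j -> owned ends O i -> owned ends O j ->
    uncut Z N i j -> d <= j - i.

Lemma spreadS L ends d d' (O Z Z1 : {set 'I_L.+1}) (N N1 : {set 'I_L}) :
  Z \subset Z1 -> N \subset N1 -> d' <= d -> spread ends d O Z N -> spread ends d' O Z1 N1.
Proof.
move=> sZ sN dd H i j ij Oi Oj /(uncutS sZ sN) un.
by apply: leq_trans dd _; exact: H.
Qed.

(** Only pairs containing [v] are new; for the others the old bound survives, since cuts only remove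
    connections. *)
Lemma spread_claim L ends d d' (O Z Z1 : {set 'I_L.+1}) (N N1 : {set 'I_L}) (v : 'I_L.+1) :
  Z \subset Z1 -> N \subset N1 -> d' <= d -> 0 < v < L -> spread ends d O Z N ->
  (forall i : 'I_L.+1, i < v -> owned ends O i -> uncut Z1 N1 i v -> d' <= v - i) ->
  (forall i : 'I_L.+1, v < i -> owned ends O i -> uncut Z1 N1 v i -> d' <= i - v) ->
  spread ends d' (v |: O) Z1 N1.
Proof.
move=> sZ sN dd vL H Hl Hr i j.
have own_neq (w : 'I_L.+1) : w != v -> owned ends (v |: O) w = owned ends O w.
  by move=> wv; rewrite /owned !inE (negPf wv).
case: (eqVneq i v) => [->|iv]; case: (eqVneq j v) => [->|jv].
- by rewrite ltnn.
- by rewrite (own_neq j) // => ij _; exact: Hr.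
- by rewrite (own_neq i) // => ij Oi _; exact: Hl.
- by rewrite !own_neq // => ij Oi Oj; exact: (spreadS sZ sN dd H).
Qed.

(** The new block can be too close to owned ones on either side. One side is cut by killing the
    neighbour of [v] or, if that is owned, all tails of the edge to it. When both sides are too
    close, [close], applied to the two distances, provides [b >= 2], and both neighbours are
    killed. *)
Lemma spread_step b L ends d d' (O Z : {set 'I_L.+1}) (N : {set 'I_L}) (v : 'I_L.+1) :
  0 < b -> d' <= d ->
  (forall x y, x < d' -> y < d' -> d <= x + y -> x + y <= L -> 1 < b /\ d' < d) ->
  spread ends d O Z N -> v \notin O -> v \notin Z ->
  exists (Z' : {set 'I_L.+1}) (N' : {set 'I_L}),
    [/\ [disjoint Z' & v |: O], #|Z'| + b * #|N'| <= b
      & spread ends d' (v |: O) (Z :|: Z') (N :|: N')].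
Proof.
move=> b0 dd close H vO vZ.
(* Claiming an end changes no value of [owned], so Breaker passes. *)
have [vL|vL] := boolP (0 < v < L); last first.
  exists set0, set0; rewrite !setU0 !cards0 muln0 disjoints_subset sub0set; split=> //.
  have own w : owned ends (v |: O) w = owned ends O w.
    rewrite /owned; case: ifP => // wL; rewrite !inE; case: eqVneq => // wv.
    by rewrite -wv wL in vL.
  move=> i j ij; rewrite !own => Oi Oj un; apply: leq_trans dd _; exact: H.
have lP : v.-1 < L.+1 by lia.
have leP : v.-1 < L by lia.
have rP : v.+1 < L.+1 by lia.
have reP : v < L by lia.
pose lv := Ordinal lP; pose le := Ordinal leP.
pose rv := Ordinal rP; pose re := Ordinal reP.
pose far_l (Z1 : {set 'I_L.+1}) (N1 : {set 'I_L}) := forall i : 'I_L.+1, i < v -> owned ends O i ->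
  uncut Z1 N1 i v -> d' <= v - i.
pose far_r (Z1 : {set 'I_L.+1}) (N1 : {set 'I_L}) := forall i : 'I_L.+1, v < i -> owned ends O i ->
  uncut Z1 N1 v i -> d' <= i - v.
pose sound (Z' : {set 'I_L.+1}) (N' : {set 'I_L}) :=
  [disjoint Z' & v |: O] /\ #|Z'| + b * #|N'| <= b.
suff [Z' [N' [[dis card] Hl Hr]]] : exists (Z' : {set 'I_L.+1}) (N' : {set 'I_L}),
    [/\ sound Z' N', far_l (Z :|: Z') (N :|: N') & far_r (Z :|: Z') (N :|: N')].
  exists Z', N'; split=> //.
  by apply: (spread_claim _ _ dd vL H) => //; exact: subsetUl.
have farS_l Z' N' : far_l Z N -> far_l (Z :|: Z') (N :|: N').
  move=> F i iv Oi un; apply: F => //; apply: uncutS un; exact: subsetUl.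
have farS_r Z' N' : far_r Z N -> far_r (Z :|: Z') (N :|: N').
  move=> F i iv Oi un; apply: F => //; apply: uncutS un; exact: subsetUl.
(* killing the left neighbour, or the link to it if it is owned, cuts [v] off *)
have kill_l (Z' : {set 'I_L.+1}) (N' : {set 'I_L}) : ~~ owned ends O lv -> (lv \notin O -> lv \in Z') ->
    far_l (Z :|: Z') (N :|: N').
  move=> Olv lvZ i iv Oi /uncutP[/(_ lv)] /=.
  have neq : i != lv by apply: contraNneq Olv => <-.
  have ilv : i < v.-1.
    rewrite ltn_neqAle; apply/andP; split; last by lia.
    by apply: contra neq => /eqP E; apply/eqP/val_inj.
  have lvO : lv \notin O.
    by move: Olv; rewrite /owned ifT //=; lia.
  have -> : (i < v.-1 < v) by lia.
  by move=> /(_ isT); rewrite inE lvZ ?orbT.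
have kill_r (Z' : {set 'I_L.+1}) (N' : {set 'I_L}) : ~~ owned ends O rv -> (rv \notin O -> rv \in Z') ->
    far_r (Z :|: Z') (N :|: N').
  move=> Orv rvZ i iv Oi /uncutP[/(_ rv)] /=.
  have neq : i != rv by apply: contraNneq Orv => <-.
  have irv : v.+1 < i.
    rewrite ltn_neqAle; apply/andP; split; last by lia.
    by apply: contra neq => /eqP E; apply/eqP/val_inj.
  have rvO : rv \notin O.
    by move: Orv; rewrite /owned ifT //=; have := ltn_ord i; lia.
  have -> : (v < v.+1 < i) by lia.
  by move=> /(_ isT); rewrite inE rvZ ?orbT.
have sep_l : far_l (Z :|: set0) (N :|: [set le]).
  move=> i iv _ /uncutP[_ /(_ le)] /=; have -> : i <= v.-1 < v by lia.
  by move=> /(_ isT); rewrite !inE eqxx orbT.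
have sep_r : far_r (Z :|: set0) (N :|: [set re]).
  move=> i iv _ /uncutP[_ /(_ re)] /=; have -> : v <= v < i by lia.
  by move=> /(_ isT); rewrite !inE eqxx orbT.
have sound_e e : sound set0 [set e].
  by split; [rewrite disjoints_subset sub0set | rewrite cards0 cards1 muln1].
have lvv : lv != v by apply/eqP => /(congr1 val) /=; lia.
have rvv : rv != v by apply/eqP => /(congr1 val) /=; lia.
have sound_v (W : {set 'I_L.+1}) : v \notin W -> #|W| <= b -> sound (W :\: O) set0.
  move=> vW Wb; split.
    apply/disjointP => x; rewrite !inE => /andP[xO xW].
    by rewrite negb_or xO andbT; apply: contraNneq vW => <-.
  rewrite cards0 muln0 addn0.
  by apply: leq_trans (subset_leq_card (subsetDl _ _)) Wb.
pose badl := [exists i : 'I_L.+1, [&& i < v, owned ends O i, uncut Z N i v & v - i < d']].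
pose badr := [exists i : 'I_L.+1, [&& v < i, owned ends O i, uncut Z N v i & i - v < d']].
have nbadl : ~~ badl -> far_l Z N.
  move=> nb i iv Oi un; rewrite leqNgt; apply: contra nb => lt.
  by apply/existsP; exists i; rewrite iv Oi un.
have nbadr : ~~ badr -> far_r Z N.
  move=> nb i iv Oi un; rewrite leqNgt; apply: contra nb => lt.
  by apply/existsP; exists i; rewrite iv Oi un.
have [bl|/nbadl fl] := boolP badl; have [br|/nbadr fr] := boolP badr.
- have /existsP[i /and4P[iv Oi un_i lt_i]] := bl.
  have /existsP[j /and4P[jv Oj un_j lt_j]] := br.
  have un_ij := uncut_cat un_i un_j vZ.
  have dij : d <= j - i by apply: H => //; exact: ltn_trans iv jv.
  have jL := ltn_ord j.
  have [//|//|||b1 dd'] := close (v - i) (j - v).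
  - by move: dij iv jv; clear; lia.
  - by move: iv jv jL; clear; lia.
  (* An owned left neighbour would be connected to [j] at distance at most [d'], below the
     guaranteed [d]. *)
  have Olv : ~~ owned ends O lv.
    apply/negP => Olv.
    have : d <= j - lv.
      apply: H => //=; first by move: jv; clear; lia.
      by apply: uncut_sub un_ij => //=; move: iv; clear; lia.
    by move: dd' lt_j jv; rewrite /=; clear; lia.
  have Orv : ~~ owned ends O rv.
    apply/negP => Orv.
    have : d <= rv - i.
      by apply: H => //=; [move: iv; clear; lia | exact: uncut_sub un_ij].
    by move: dd' lt_i iv; rewrite /=; clear; lia.
  (* Removing [O] matters when a neighbour is an end: it may be claimed without counting as
     owned. *)
  exists ([set lv; rv] :\: O), set0; split.
  + apply: sound_v; first by rewrite !inE negb_or ![v == _]eq_sym lvv.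
    by rewrite cards2; case: (_ != _).
  + by apply: kill_l => // lvO; rewrite !inE lvO eqxx.
  + by apply: kill_r => // rvO; rewrite !inE rvO eqxx orbT.
- have [Olv|Olv] := boolP (owned ends O lv).
    by exists set0, [set le]; split=> //; exact: farS_r.
  exists ([set lv] :\: O), set0; split; [|apply: kill_l => // lvO|exact: farS_r].
    by apply: sound_v; rewrite ?cards1 // inE eq_sym.
  by rewrite !inE lvO eqxx.
- have [Orv|Orv] := boolP (owned ends O rv).
    by exists set0, [set re]; split=> //; exact: farS_l.
  exists ([set rv] :\: O), set0; split; [|exact: farS_l|apply: kill_r => // rvO].
    by apply: sound_v; rewrite ?cards1 // inE eq_sym.
  by rewrite !inE rvO eqxx.
exists set0, set0; split; [|exact: farS_l|exact: farS_r].
by split; [rewrite disjoints_subset sub0set | rewrite !cards0 muln0].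
Qed.

(* A pair of owned ends at distance [d] takes Maker about [log d] rounds if
   [b = 1], where she can halve the distance, and [d] rounds if [b >= 2], where
   Breaker can cut both halves at once. *)
Definition stretch (b r : nat) : nat := if b == 1 then 2 ^ r.-1 else r.

Lemma stretch_leq b r : stretch b r.-1 <= stretch b r.
Proof. by rewrite /stretch; case: ifP => _; rewrite ?leq_exp2l ?leq_pred. Qed.

(** For [b = 1] the inequalities are contradictory, as [stretch] at most doubles from one round to
    the next; for larger [b] it grows by one. *)
Lemma stretch_close b r x y : 0 < b ->
  x < stretch b r.-1 -> y < stretch b r.-1 -> stretch b r <= x + y ->
  1 < b /\ stretch b r.-1 < stretch b r.
Proof.
rewrite /stretch; case: (eqVneq b 1) => [_ _|b1 b0].
  case: r => [|[|r]] /=; rewrite ?expn0; try lia.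
  by rewrite expnS; lia.
by case: r => [|r] /=; lia.
Qed.

Lemma core_link_owned L (O : {set 'I_L.+1}) (e : 'I_L) (v : 'I_L.+1) ends :
  @core (link L) e \subset O -> e <= v <= e.+1 -> (0 < v < L) || ends ->
  owned ends O v.
Proof.
move=> /subsetP sO ev; rewrite /owned; case: ifP => //= vL _.
by apply: sO; rewrite inE vL.
Qed.

Lemma link_live L ends d (O Z : {set 'I_L.+1}) N (e : 'I_L) :
  spread ends d O Z N -> 1 < d -> @core (link L) e \subset O ->
  (0 < e) && (e.+1 < L) || ends -> e \in N.
Proof.
move=> H d1 eO ends'; apply: contraT => eN.
have eL := ltn_ord e.
have e1P : e < L.+1 by lia.
have e2P : e.+1 < L.+1 by lia.
have : d <= Ordinal e2P - Ordinal e1P.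
  apply: H => //=.
  - by apply: core_link_owned eO _ _ => /=; lia.
  - by apply: core_link_owned eO _ _ => /=; lia.
  apply/uncutP; split=> [v|f] /=; first by lia.
  by move=> fe; have -> : f = e by apply: val_inj => /=; lia.
by rewrite /=; lia.
Qed.

(** Connected owned blocks stay [stretch b r] apart. If the clock is still positive after the next
    move, then [r >= 2] and this distance exceeds 1, so no uncut edge has an owned core. *)
Lemma link_holds b t : 0 < b ->
  holds b (fun r (_ : edge (link (stretch b t))) => 0 < r) t set0 set0 set0.
Proof.
move=> b0; set L := stretch b t.
exists (fun r (O Z : {set vertex (link L)}) N => spread true (stretch b r) O Z N).
  move=> r O Z N H; split.
  - move=> e r1 eO; apply: link_live H _ eO _; last by rewrite orbT.
    rewrite /stretch; case: ifP => _; last by lia.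
    by rewrite -[1]/(2 ^ 0) ltn_exp2l.
  - by move=> Z1 N1 sZ sN _; exact: (spreadS sZ sN (stretch_leq b r) H).
  move=> v vO vZ.
  apply: (spread_step b0 (stretch_leq b r) _ H vO vZ).
  by move=> x y xd yd dxy _; exact: stretch_close b0 xd yd dxy.
move=> i j ij Oi Oj _; have := ltn_ord j.
by move: Oi Oj; rewrite /owned !inE; do 2 case: ifP => //; rewrite -/L; lia.
Qed.

(** With dead ends, a spread of [L.+1] says that no two owned blocks are connected. It lasts
    forever: two distances within the path sum to at most [L], so two sides never need cutting at
    once. *)
Lemma link_dead_holds b L r (O Z : {set vertex (link L)}) N : 0 < b -> #|O| <= 1 ->
  holds b (fun _ (e : edge (link L)) => (0 < e) && (e.+1 < L)) r O Z N.
Proof.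
move=> b0 O1.
exists (fun _ (O Z : {set vertex (link L)}) N => spread false L.+1 O Z N).
  move=> {}r {O1}O {}Z {}N H; split.
  - move=> e eL eO; apply: link_live H _ eO _; last by rewrite eL.
    by have := ltn_ord e; lia.
  - by move=> Z1 N1 sZ sN _; exact: (spreadS sZ sN _ H).
  move=> v vO vZ; apply: (spread_step b0 (leqnn _) _ H vO vZ).
  by move=> x y ? ? ? ?; lia.
move=> i j ij; rewrite /owned; case: ifP => // _ iO; case: ifP => // _ jO.
have /(_ _ _ iO jO) E := card_le1_eqP O1.
by rewrite E ltnn in ij.
Qed.

(** At distance 2 the middle block completes two cores. Otherwise, for [b = 1] Maker claims the
    midpoint and continues in a half that Breaker's single touch misses; for [b >= 2] she claims the
    block next to [i], and the forced reply leaves the rest, shorter by one, intact. *)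
Lemma link_forces b L n (O Z : {set 'I_L.+1}) (N : {set 'I_L}) (i j : 'I_L.+1) :
  0 < b -> 1 < n -> i + stretch b n = j -> owned true O i -> owned true O j ->
  (forall v : 'I_L.+1, i < v < j -> v \notin O /\ v \notin Z) ->
  (forall e : 'I_L, i <= e < j -> e \notin N) ->
  @forces b (link L) setT n O Z N.
Proof.
move=> b0; elim: n O Z N i j => [//|n IH] O Z N i j n0 ij Oi Oj HV HE.
have jL := ltn_ord j.
have live (v : 'I_L.+1) (e : 'I_L) :
    (forall w : 'I_L.+1, e <= w <= e.+1 -> (w == v) || owned true O w) ->
    @core (link L) e \subset v |: O.
  move=> Hw; apply/subsetP => w; rewrite !inE => /andP[wL /Hw].
  by rewrite /owned wL.
have ownS (v w : 'I_L.+1) : owned true O w -> owned true (v |: O) w.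
  by rewrite /owned; case: ifP => // _; rewrite inE orbC => ->.
have own1 (v : 'I_L.+1) : owned true (v |: O) v.
  by rewrite /owned setU11; case: ifP.
have at_i (w : 'I_L.+1) : w = i :> nat -> owned true O w.
  by move/ord_inj->.
have at_j (w : 'I_L.+1) : w = j :> nat -> owned true O w.
  by move/ord_inj->.
have claimable (v : 'I_L.+1) : i < v < j -> [/\ v \in [set: 'I_L.+1], v \notin O & v \notin Z].
  by move=> /HV[]; rewrite inE.
have nn : n = 1 \/ 1 < n by lia.
case: nn => [n1|n1].
  have ij2 : j = i.+2 :> nat by rewrite -ij n1 /stretch /=; case: ifP => _ /=; lia.
  have vP : i.+1 < L.+1 by lia.
  have e1P : i < L by lia.
  have e2P : i.+1 < L by lia.
  exists (Ordinal vP); have [|? ? ?] := claimable (Ordinal vP); first by rewrite /=; lia.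
  split=> //; constructor 1; split; first by rewrite n1.
  exists (Ordinal e1P), (Ordinal e2P); split; first by apply/eqP => /(congr1 val) /=; lia.
  - apply/andP; split; last by apply: HE => /=; lia.
    apply: live => w /= wi.
    case: (eqVneq w (Ordinal vP)) => //= /eqP nv; apply: at_i.
    suff : w <> i.+1 :> nat by lia.
    by move=> E; apply: nv; apply: ord_inj.
  - apply/andP; split; last by apply: HE => /=; lia.
    apply: live => w /= wi.
    case: (eqVneq w (Ordinal vP)) => //= /eqP nv; apply: at_j.
    suff : w <> i.+1 :> nat by lia.
    by move=> E; apply: nv; apply: ord_inj.
have [b1|b1] := eqVneq b 1.
  set h := 2 ^ n.-1.
  have strE : stretch b n.+1 = h + h.
    by rewrite /stretch b1 /= /h -[n in LHS](ltn_predK n1) expnS; lia.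
  have strE' : stretch b n = h by rewrite /stretch b1.
  have h0 : 0 < h by rewrite expn_gt0.
  have vP : i + h < L.+1 by lia.
  exists (Ordinal vP); have [|? ? ?] := claimable (Ordinal vP); first by rewrite /=; lia.
  split=> //; constructor 3 => Y Y1.
  have misses : (forall x, x \in Y -> match x with inl w => i + h <= w | inr e => i + h <= e end) \/
      (forall x, x \in Y -> match x with inl w => w <= i + h | inr e => e < i + h end).
    have [->|[y yY]] := set_0Vmem Y; first by left => x; rewrite inE.
    have Yy x : x \in Y -> x = y.
      have /card_le1_eqP Yeq : #|Y| <= 1 by rewrite -b1.
      by move=> xY; exact: Yeq.
    case: y {yY} Yy => [w|e] Yy.
      by case: (leqP (i + h) w) => ?; [left|right] => x /Yy ->; lia.
    by case: (leqP (i + h) e) => ?; [left|right] => x /Yy ->; lia.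
  case: misses => miss.
    apply: (IH _ _ _ i (Ordinal vP)) => //=; rewrite ?strE' //; first exact: ownS.
      move=> w wi; have [|wO wZ] := HV w; first by lia.
      rewrite !inE !negb_or wO wZ andbT /=; split.
        by apply/eqP => /(congr1 val) /=; lia.
      by apply/negP => /miss; lia.
    move=> e ei; rewrite inE negb_or HE /=; last by lia.
    by rewrite inE; apply/negP => /miss; lia.
  apply: (IH _ _ _ (Ordinal vP) j) => //=; rewrite ?strE' //; first by lia.
  - exact: ownS.
  - move=> w wi; have [|wO wZ] := HV w; first by lia.
    rewrite !inE !negb_or wO wZ andbT /=; split.
      by apply/eqP => /(congr1 val) /=; lia.
    by apply/negP => /miss; lia.
  move=> e ei; rewrite inE negb_or HE /=; last by lia.
  by rewrite inE; apply/negP => /miss; lia.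
have strE k : stretch b k = k by rewrite /stretch (negPf b1).
rewrite strE in ij.
have vP : i.+1 < L.+1 by lia.
have eP : i < L by lia.
exists (Ordinal vP); have [|? ? ?] := claimable (Ordinal vP); first by rewrite /=; lia.
split=> //; constructor 2; exists (Ordinal eP).
  apply/andP; split; last by apply: HE => /=; lia.
  apply: live => w /= wi.
  case: (eqVneq w (Ordinal vP)) => //= /eqP nv; apply: at_i.
  suff : w <> i.+1 :> nat by lia.
  by move=> E; apply: nv; apply: ord_inj.
apply: (IH _ _ _ (Ordinal vP) j) => //=; rewrite ?strE; first by lia.
- exact: ownS.
- move=> w wi; have [|wO wZ] := HV w; first by lia.
  split=> //; rewrite !inE negb_or wO andbT.
  by apply/eqP => /(congr1 val) /=; lia.
move=> e ei; rewrite !inE negb_or HE ?andbT; last by lia.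
by apply/eqP => /(congr1 val) /=; lia.
Qed.

(** * Gluing gadgets *)

Lemma disjoint_claimU (T : finType) (v : T) (O Z Z' : {set T}) :
  v \notin Z -> [disjoint O & Z] -> [disjoint Z' & v |: O] ->
  [disjoint v |: O & Z :|: Z'].
Proof.
move=> vZ dOZ dZ'; apply/disjointP => x xvO; rewrite inE (disjointFl dZ' xvO) orbF.
by case/setU1P: xvO => [->//|xO]; rewrite (disjointFr dOZ xO).
Qed.

(** Breaker may forget extra hits and answer as if only [Z] and [N] were his. *)
Lemma holdsS b (G : gadget) guard r (O Z Z1 : {set vertex G}) (N N1 : {set edge G}) :
  Z \subset Z1 -> N \subset N1 -> [disjoint O & Z1] ->
  holds b guard r O Z N -> holds b guard r O Z1 N1.
Proof.
move=> sZ sN dO h.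
exists (fun r (O Z1 : {set vertex G}) (N1 : {set edge G}) =>
  exists (Z : {set vertex G}) (N : {set edge G}), [/\ Z \subset Z1, N \subset N1, [disjoint O & Z1]
  & holds b guard r O Z N]); last by exists Z, N.
move=> {O Z Z1 N N1 sZ sN dO h} {}r O Z1 N1 [Z [N [sZ sN dO h]]].
have [live pass step] := hold_inv_holds h; split.
- by move=> e ge eO; apply: (subsetP sN); exact: live.
- move=> Z2 N2 sZ2 sN2 dO2; exists Z, N; split=> //.
  + exact: subset_trans sZ sZ2.
  + exact: subset_trans sN sN2.
  by apply: pass => //; exact: disjointWr sZ dO.
move=> v vO vZ1; have vZ : v \notin Z by apply: contra vZ1; exact: (subsetP sZ).
have [Z' [N' [dZ' card h']]] := step v vO vZ.
exists Z', N'; split=> //; exists (Z :|: Z'), (N :|: N'); split=> //.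
- exact: setSU.
- exact: setSU.
exact: disjoint_claimU.
Qed.

Lemma holds_leq b (G : gadget) guard r r' (O Z : {set vertex G}) (N : {set edge G}) :
  r' <= r -> [disjoint O & Z] -> holds b guard r O Z N -> holds b guard r' O Z N.
Proof.
move=> /subnK <- dO; elim: (r - r') => [|k IH] //; rewrite addSn => /hold_inv_holds.
by case=> _ /(_ Z N) pass _; apply: IH; apply: pass.
Qed.

Lemma preimsetU (aT rT : finType) (f : aT -> rT) (A B : {set rT}) :
  f @^-1: (A :|: B) = f @^-1: A :|: f @^-1: B.
Proof. by apply/setP => x; rewrite !inE. Qed.

Lemma preim_disjoint (aT rT : finType) (f : aT -> rT) (A B : {set rT}) :
  [disjoint A & B] -> [disjoint f @^-1: A & f @^-1: B].
Proof. by move=> d; apply/disjointP => x; rewrite !inE => /(disjointFr d) ->. Qed.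

(** Breaker answers in the part where Maker moved; for the other parts the round is a pass. Cores
    may be larger in [H] than in their part, which only helps Breaker. *)
Lemma holds_split b (H : gadget) (J : finType) (G : J -> gadget)
    (f : forall i, vertex (G i) -> vertex H) (g : forall i, edge (G i) -> edge H)
    (guard : nat -> edge H -> bool) (guard_ : forall i, nat -> edge (G i) -> bool)
    r (O Z : {set vertex H}) (N : {set edge H}) :
  (forall i, injective (f i)) -> (forall i j x y, f i x = f j y -> i = j) ->
  (forall v, v \notin O -> v \notin Z -> exists i x, v = f i x) ->
  (forall e, ~~ [disjoint core e & Z] \/
     exists i e', [/\ e = g i e', f i @: core e' \subset core e
       & forall r, guard r e -> guard_ i r e']) ->
  [disjoint O & Z] ->
  (forall i, holds b (guard_ i) r (f i @^-1: O) (f i @^-1: Z) (g i @^-1: N)) ->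
  holds b guard r O Z N.
Proof.
move=> finj fdis cov ecov dOZ parts.
exists (fun r (O Z : {set vertex H}) (N : {set edge H}) => [/\ forall v, v \notin O -> v \notin Z -> exists i x, v = f i x,
  forall e, ~~ [disjoint core e & Z] \/
     exists i e', [/\ e = g i e', f i @: core e' \subset core e
       & forall r, guard r e -> guard_ i r e'],
  [disjoint O & Z]
  & forall i, holds b (guard_ i) r (f i @^-1: O) (f i @^-1: Z) (g i @^-1: N)]) => //.
move=> {O Z N cov ecov dOZ parts} {}r O Z N [cov ecov dOZ parts].
have ecovS (Z1 : {set vertex H}) : Z \subset Z1 -> forall e, ~~ [disjoint core e & Z1] \/
     exists i e', [/\ e = g i e', f i @: core e' \subset core e
       & forall r, guard r e -> guard_ i r e'].
  move=> sZ e; have [hit|] := ecov e; last by right.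
  by left; apply: contra hit; exact: disjointWr.
split.
- move=> e ge eO; have [|[i [e' [eE fe gi]]]] := ecov e.
    by rewrite (disjointWl eO dOZ).
  have [live _ _] := hold_inv_holds (parts i).
  have := live e' (gi _ ge); rewrite eE !inE; apply.
  by rewrite -sub_imset_pre; exact: subset_trans fe eO.
- move=> Z1 N1 sZ sN dO1; split=> //; last first.
  + move=> i; have [_ pass _] := hold_inv_holds (parts i).
    by apply: pass; [exact: preimsetS | exact: preimsetS | exact: preim_disjoint].
  + exact: ecovS.
  + by move=> v vO vZ1; apply: cov => //; apply: contra vZ1; exact: (subsetP sZ).
move=> v vO vZ; have [i [x vE]] := cov v vO vZ; subst v.
have [live pass step] := hold_inv_holds (parts i).
have [||Z' [N' [dZ' card hi]]] := step x; try by rewrite inE.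
have pre1 : f i @^-1: (f i x |: O) = x |: f i @^-1: O.
  by apply/setP => y; rewrite !inE (inj_eq (finj i)).
exists (f i @: Z'), (g i @: N'); split.
- apply/disjointP => _ /imsetP[y yZ' ->]; rewrite !inE (inj_eq (finj i)).
  by have := disjointFr dZ' yZ'; rewrite !inE => ->.
- apply: leq_trans card; apply: leq_add; first exact: leq_imset_card.
  by rewrite leq_mul2l leq_imset_card orbT.
have dO' : [disjoint f i x |: O & Z :|: f i @: Z'].
  apply: disjoint_claimU => //; apply/disjointP => _ /imsetP[y yZ' ->].
  by have := disjointFr dZ' yZ'; rewrite !inE (inj_eq (finj i)) => ->.
split=> //.
- move=> v; rewrite !inE !negb_or => /andP[_ vO'] /andP[vZ' _]; exact: cov.
- by apply: ecovS; exact: subsetUl.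
move=> j; case: (eqVneq i j) => [ij|ij].
  subst j; move: hi; rewrite -pre1; apply: holdsS.
  + by rewrite preimsetU setUS // -sub_imset_pre.
  + by rewrite preimsetU setUS // -sub_imset_pre.
  exact: preim_disjoint.
have [_ passj _] := hold_inv_holds (parts j).
have pre0 : f j @^-1: (f i x |: O) = f j @^-1: O.
  apply/setP => y; rewrite !inE; case: eqP => //= /fdis ji.
  by rewrite ji eqxx in ij.
rewrite pre0; apply: passj.
- by rewrite preimsetU subsetUl.
- by rewrite preimsetU subsetUl.
by rewrite -pre0; exact: preim_disjoint.
Qed.

(** Maker transfers her play along [f] and [g]. Cores in [H] may contain further blocks that she
    already owns, such as a root; by injectivity, pulling back Breaker's reply does not enlarge
    it. *)
Lemma forces_embed b (G H : gadget) (f : vertex G -> vertex H) (g : edge G -> edge H)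
    (U : {set vertex H}) n (O Z : {set vertex G}) (N : {set edge G})
    (O' Z' : {set vertex H}) (N' : {set edge H}) :
  injective f -> injective g -> f @: setT \subset U ->
  (forall e, core (g e) \subset f @: core e :|: O') ->
  f @^-1: O' = O -> f @^-1: Z' \subset Z -> g @^-1: N' \subset N ->
  forces b setT n O Z N -> forces b U n O' Z' N'.
Proof.
move=> finj ginj fU.
elim: n O Z N O' Z' N' => //= n IH O Z N O' Z' N' HD OE sZ sN [v [_ vO vZ Hv]].
have HD' e : core (g e) \subset f @: core e :|: (f v |: O').
  by apply: subset_trans (HD e) _; apply: setUS; exact: subsetUr.
have OE' : f @^-1: (f v |: O') = v |: O.
  by rewrite -OE; apply/setP => y; rewrite !inE (inj_eq finj).
have live e : (core e \subset v |: O) && (e \notin N) ->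
    (core (g e) \subset f v |: O') && (g e \notin N').
  case/andP=> eO eN; apply/andP; split.
    apply: subset_trans (HD' e) _; rewrite subUset subxx andbT.
    by rewrite sub_imset_pre OE'.
  by apply: contra eN => gN; apply: (subsetP sN); rewrite inE.
exists (f v); split.
- by apply: (subsetP fU); exact: imset_f.
- by move: vO; rewrite -OE inE.
- by apply: contra vZ => fZ; apply: (subsetP sZ); rewrite inE.
case: Hv => [[n0 [e1 [e2 [e12 l1 l2]]]]|[e le fe]|fY].
- constructor 1; split=> //; exists (g e1), (g e2).
  by rewrite (inj_eq ginj); split=> //; exact: live.
- constructor 2; exists (g e); first exact: live.
  apply: (IH (v |: O) Z (e |: N)) => //.
  apply/subsetP => x; rewrite !inE (inj_eq ginj) => /orP[->//|gx].
  by rewrite (subsetP sN) ?orbT // inE.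
constructor 3 => Y Yb.
pose h (y : vertex G + edge G) : vertex H + edge H :=
  match y with inl x => inl (f x) | inr e => inr (g e) end.
have hinj : injective h by move=> [x|x] [y|y] //= [] => [/finj|/ginj] ->.
apply: (IH (v |: O) (Z :|: inl @^-1: (h @^-1: Y)) (N :|: inr @^-1: (h @^-1: Y))) => //.
- by rewrite preimsetU; apply: setUSS => //; apply/subsetP => x; rewrite !inE.
- by rewrite preimsetU; apply: setUSS => //; apply/subsetP => x; rewrite !inE.
apply: fY; apply: leq_trans Yb; rewrite -(card_imset _ hinj).
by apply: subset_leq_card; apply/subsetP => _ /imsetP[y yY ->]; rewrite inE in yY.
Qed.

(** * Branching below a root *)

(* A root [None] with [b.+1] copies of [G] below it; the root is added to the
   cores of the [rooted] edges. *)
Definition branch (b : nat) (G : gadget) (rooted : pred (edge G)) : gadget :=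
  @Gadget (option ('I_b.+1 * vertex G)) ('I_b.+1 * edge G)%type
    (fun e => [set Some (e.1, v) | v in core e.2] :|:
              (if rooted e.2 then [set None] else set0)).

Lemma spare_copy (b : nat) (T : finType) (k : T -> option 'I_b.+1) (Y : {set T}) :
  #|Y| <= b -> exists p, forall y, y \in Y -> k y != Some p.
Proof.
move=> Yb; have : ~~ ([set Some p | p : 'I_b.+1] \subset k @: Y).
  apply/negP => /subset_leq_card.
  rewrite (card_imset (f := Some)) => [|i j [] //].
  rewrite card_ord leqNgt ltnS; apply/negP; rewrite negbK.
  exact: leq_trans (leq_imset_card _ _) Yb.
case/subsetPn => _ /imsetP[p _ ->] np; exists p => y yY.
by apply: contra np => /eqP <-; exact: imset_f.
Qed.

(** Maker opens with the root. Breaker's free answer misses one of the [b.+1] copies, in which the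
    rooted cores now lack only their blocks in [G]. *)
Lemma branch_forces b (G : gadget) (rooted : pred (edge G)) n :
  @forces b G setT n set0 set0 set0 ->
  @forces b (branch b rooted) setT n.+1 set0 set0 set0.
Proof.
move=> fG; exists None; rewrite !inE; split=> //; constructor 3 => Y Yb.
pose k (y : vertex (branch b rooted) + edge (branch b rooted)) : option 'I_b.+1 :=
  match y with inl x => omap fst x | inr e => Some e.1 end.
have [p Hp] := spare_copy k Yb.
apply: (@forces_embed b G (branch b rooted) (fun v => Some (p, v)) (fun e => (p, e)) _ _
  set0 set0 set0) => //.
- by move=> x y [].
- by move=> x y [].
- move=> e /=; apply: setUS; case: ifP => _; last exact: sub0set.
  exact: subsetUl.
- by apply/setP => x; rewrite !inE.
- by apply/subsetP => x; rewrite !inE /= => /Hp; rewrite /= eqxx.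
- by apply/subsetP => x; rewrite !inE /= => /Hp; rewrite /= eqxx.
Qed.

(** The unrooted edges are those that survive the death of the root; [O] may contain the one block
    Maker claimed before Breaker killed it. *)
Definition dead_root_holds b (G : gadget) (rooted : pred (edge G)) : Prop :=
  forall r (O Z : {set vertex G}) N, #|O| <= 1 ->
    holds b (fun _ e => ~~ rooted e) r O Z N.

Lemma branch_dead b (G : gadget) (rooted : pred (edge G)) guard r
    (O Z : {set vertex (branch b rooted)}) (N : {set edge (branch b rooted)}) :
  dead_root_holds b rooted -> None \in Z -> [disjoint O & Z] -> #|O| <= 1 ->
  holds b guard r O Z N.
Proof.
move=> HG rZ dO O1.
apply: (@holds_split b (branch b rooted) 'I_b.+1 (fun=> G)
  (fun p v => Some (p, v)) (fun p e => (p, e)) _ (fun _ _ e => ~~ rooted e)) => //.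
- by move=> i x y [].
- by move=> i j x y [].
- by move=> [[p v]|] vO vZ; [exists p, v | rewrite rZ in vZ].
- move=> [p e]; have [re|re] := boolP (rooted e).
    by left; apply/not_disjointP; exists None => //; rewrite /= re !inE orbT.
  by right; exists p, e; split=> //=; exact: subsetUl.
move=> p; apply: HG; apply: leq_trans O1.
rewrite -(card_imset _ (f := fun v => Some (p, v))) => [|x y [] //].
by apply: subset_leq_card; apply/subsetP => _ /imsetP[y yO ->]; rewrite inE in yO.
Qed.

(** If Maker's first block is the root, Breaker passes and the copies start with one round less; if
    it is another block, he kills the root and holds forever. [start] covers the positions before
    that, the round for the root being already deducted in [r.-1]. *)
Lemma branch_holds b (G : gadget) (rooted : pred (edge G)) n :
  0 < b -> dead_root_holds b rooted ->
  (forall e, rooted e \/ core e != set0) ->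
  holds b (fun r (_ : edge G) => 0 < r) n set0 set0 set0 ->
  holds b (fun r (_ : edge (branch b rooted)) => 0 < r) n.+1 set0 set0 set0.
Proof.
move=> b0 HG ne hG; set H := branch b rooted.
pose gd := fun r (_ : edge H) => 0 < r.
pose start r (O Z : {set vertex H}) (N : {set edge H}) :=
  [/\ O = set0, None \notin Z & forall p : 'I_b.+1,
    holds b (fun r (_ : edge G) => 0 < r) r.-1 set0
      ((fun v => Some (p, v)) @^-1: Z) ((fun e => (p, e)) @^-1: N)].
exists (fun r O Z N => start r O Z N \/ holds b gd r O Z N); last first.
  left; split=> [//||p]; first by rewrite inE.
  by rewrite /=; apply: holdsS hG; rewrite ?sub0set // disjoints_subset sub0set.
move=> r O Z N [[-> rZ parts]|/hold_inv_holds[live pass step]]; last first.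
  split=> //; first by move=> *; right; exact: pass.
  move=> v vO vZ; have [Z' [N' [? ? ?]]] := step v vO vZ.
  by exists Z', N'; split=> //; right.
split.
- move=> [p e] _ /=; rewrite subset0 setU_eq0 => /andP[/eqP e0 /eqP r0].
  have [re|/set0Pn[v ve]] := ne e.
    by have := set11 (None : option ('I_b.+1 * vertex G)); rewrite re in r0; rewrite r0 inE.
  have : Some (p, v) \in [set Some (p, v) | v in core e] by exact: imset_f.
  by rewrite e0 inE.
- move=> Z1 N1 sZ sN dO.
  have [rZ1|rZ1] := boolP (None \in Z1).
    by right; apply: branch_dead; rewrite ?cards0.
  left; split=> // p; have [_ passp _] := hold_inv_holds (parts p).
  apply: passp; [exact: preimsetS | exact: preimsetS |].
  by rewrite disjoints_subset sub0set.
move=> [[p v]|] _ vZ; last first.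
  exists set0, set0; rewrite !cards0 muln0 !setU0 disjoints_subset sub0set; split=> //.
  right; apply: (@holds_split b H 'I_b.+1 (fun=> G)
    (fun p v => Some (p, v)) (fun p e => (p, e)) _ (fun _ r _ => 0 < r)).
  + by move=> i x y [].
  + by move=> i j x y [].
  + by move=> [[p v]|]; rewrite !inE //; exists p, v.
  + by move=> [p e]; right; exists p, e; split=> //=; exact: subsetUl.
  + by apply/disjointP => x; rewrite inE => /eqP->.
  move=> p; have -> // : (fun v => Some (p, v)) @^-1: [set None] = set0 :> {set vertex G}.
  by apply/setP => x; rewrite !inE.
exists [set None], set0; rewrite cards0 cards1 muln0 addn0; split=> //.
  by rewrite disjoints1 !inE.
have dO : [disjoint [set Some (p, v)] & Z :|: [set None]].
  by rewrite disjoints1 !inE negb_or vZ.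
by right; apply: branch_dead; rewrite ?setU0 ?cards1 // !inE orbT.
Qed.

(** * Gadgets with given core size and number of rounds *)

Lemma card_core_branch b (G : gadget) (rooted : pred (edge G)) (e : edge (branch b rooted)) :
  #|core e| = #|core e.2| + rooted e.2.
Proof.
have cS : #|[set Some (e.1, v) | v in core e.2]| = #|core e.2|.
  by rewrite card_imset // => x y [].
case: e cS => [p e] /= cS; case: (rooted e); last by rewrite setU0 cS addn0.
by rewrite setUC cardsU1 cS addnC; case: imsetP => // -[].
Qed.

(** The edges at the ends of the path: identifying the ends with the root puts it into exactly these
    cores. *)
Definition end_link L : pred (edge (link L)) := fun e => ~~ ((0 < e) && (e.+1 < L)).

Lemma card_core_link L (e : edge (link L)) : 1 < L -> #|core e| + end_link e = 2.
Proof.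
case: e => e eL L1.
have e0P : e < L.+1 by lia.
have e1P : e.+1 < L.+1 by lia.
rewrite /end_link; set C := core _; rewrite /=.
have [e0|e0] := posnP e.
  have -> : C = [set Ordinal e1P].
    by apply/setP => v; rewrite !inE -val_eqE /=; lia.
  by rewrite cards1 e0.
have [eL1|eL1] := ltnP e.+1 L.
  have -> : C = [set Ordinal e0P; Ordinal e1P].
    by apply/setP => v; rewrite !inE -!val_eqE /=; lia.
  by rewrite cards2 -val_eqE /=; lia.
have -> : C = [set Ordinal e0P].
  by apply/setP => v; rewrite !inE -val_eqE /=; lia.
by rewrite cards1.
Qed.

(** Induction on [q]: a branch over paths gives cores of size 2, and each further root, added to all
    cores, costs one block and one round. The path at the bottom thus has to last [t - q + 1]
    rounds. *)
Lemma exists_gadget b q t : 0 < b -> 1 < q -> q < t ->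
  exists (G : gadget) (root : vertex G),
    [/\ forall e : edge G, #|core e| = q,
        @forces b G setT t set0 set0 set0,
        holds b (fun r (_ : edge G) => 0 < r) t set0 set0 set0
      & forall r, holds b (fun _ (_ : edge G) => true) r set0 [set root] set0].
Proof.
move=> b0; elim: q t => [//|q IH] [//|t] q1 qt.
have dis0 (G : gadget) (Z : {set vertex G}) : [disjoint set0 & Z].
  by rewrite disjoints_subset sub0set.
have killed (G : gadget) (rooted : pred (edge G)) : dead_root_holds b rooted ->
    forall r, holds b (fun _ (_ : edge (branch b rooted)) => true) r set0 [set None] set0.
  by move=> HG r; apply: branch_dead; rewrite ?inE ?cards0.
have [q2|q2] : q = 1 \/ 1 < q by lia.
  set L := stretch b t.
  have t1 : 1 < t by lia.
  have L1 : 1 < L.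
    rewrite /L /stretch; case: ifP => // _.
    by rewrite -[1]/(2 ^ 0) ltn_exp2l //; lia.
  have dead : dead_root_holds b (@end_link L).
    move=> r O Z N O1; have := link_dead_holds r Z N b0 O1.
    rewrite (_ : (fun _ _ => _) = (fun _ e => ~~ end_link e)) //.
    by apply/funext => k; apply/funext => e; rewrite /end_link negbK.
  exists (branch b (@end_link L)), None; split.
  - by move=> e; rewrite card_core_branch card_core_link // q2.
  - apply: branch_forces; apply: (@link_forces b L t _ _ _ ord0 ord_max) => //.
    + by rewrite /owned ltnn andbF.
    + by move=> v _; rewrite !inE.
    + by move=> e _; rewrite inE.
  - apply: branch_holds => //; last exact: link_holds.
    move=> e; have := card_core_link e L1; case: (end_link e) => E; first by left.
    by right; rewrite -card_gt0; lia.
  exact: killed.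
have [||G [root [sz fo ho _]]] := IH t; [by lia | by lia |].
(* Every edge is rooted, so nothing is left to guard and the trivial invariant works. *)
have dead : dead_root_holds b (xpredT : pred (edge G)).
  move=> r O Z N _; exists (fun _ _ _ _ => True) => // {}r {}O {}Z {}N _; split=> // v _ _.
  by exists set0, set0; rewrite !cards0 muln0.
exists (branch b (xpredT : pred (edge G))), None; split.
- by move=> e; rewrite card_core_branch sz addn1.
- exact: branch_forces.
- by apply: branch_holds => // e; left.
exact: killed.
Qed.

(** * The combined hypergraph *)

Definition combine (b : nat) (A B : gadget) : gadget :=
  @Gadget (vertex A + 'I_b.+1 * vertex B)%type (edge A + 'I_b.+1 * edge B)%type
    (fun e => match e with
              | inl e => [set inl v | v in core e]
              | inr (p, e) => [set inr (p, v) | v in core e]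
              end).

(** The components are independent, so [holds_split] applies; [Z] allows for a root of [A] killed in
    advance. *)
Lemma combine_holds b (A B : gadget) (guard : nat -> edge (combine b A B) -> bool)
    (gA : nat -> edge A -> bool) (gB : nat -> edge B -> bool) r (Z : {set vertex A}) :
  (forall r e, guard r (inl e) -> gA r e) ->
  (forall r p e, guard r (inr (p, e)) -> gB r e) ->
  holds b gA r set0 Z set0 -> holds b gB r set0 set0 set0 ->
  @holds b (combine b A B) guard r set0 [set inl v | v in Z] set0.
Proof.
move=> HgA HgB hA hB.
pose G (i : option 'I_b.+1) := if i is Some _ then B else A.
pose f i : vertex (G i) -> vertex (combine b A B) :=
  match i return vertex (G i) -> vertex (combine b A B) with
  | Some p => fun v => inr (p, v) | None => fun v => inl v end.
pose g i : edge (G i) -> edge (combine b A B) :=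
  match i return edge (G i) -> edge (combine b A B) with
  | Some p => fun v => inr (p, v) | None => fun v => inl v end.
pose gd i : nat -> edge (G i) -> bool :=
  match i return nat -> edge (G i) -> bool with Some _ => gB | None => gA end.
apply: (@holds_split b (combine b A B) _ G f g guard gd).
- by move=> [p|] x y [].
- by move=> [p|] [p'|] x y //= [] ->.
- by move=> [v|[p v]] _ _; [exists None, v | exists (Some p), v].
- move=> [e|[p e]]; right; [exists None, e | exists (Some p), e]; split=> // k.
    exact: HgA.
  exact: HgB.
- by rewrite disjoints_subset sub0set.
move=> [p|] /=.
  have -> : f (Some p) @^-1: set0 = set0 by apply/setP => x; rewrite !inE.
  have -> : g (Some p) @^-1: set0 = set0 by apply/setP => x; rewrite !inE.
  rewrite (_ : _ @^-1: _ = set0) //; apply/setP => x; rewrite !inE.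
  by apply/imsetP => -[].
have -> : f None @^-1: set0 = set0 by apply/setP => x; rewrite !inE.
have -> : g None @^-1: set0 = set0 by apply/setP => x; rewrite !inE.
rewrite (_ : _ @^-1: _ = Z) //; apply/setP => x; rewrite !inE.
by rewrite mem_imset // => ? ? [].
Qed.

Theorem theorem1p2 (m b s s' t t' : nat)
    (hm : 0 < m) (hb : 0 < b) (hs : 0 < s) (hs' : 0 < s')
    (ht : 0 < t) (ht' : 0 < t')
    (hss' : s <= s') (hs2m : 2 * m + 1 <= s) (hmb : m <= b)
    (htt' : t <= t') (hts : ceil_div s m <= t) (hts' : ceil_div s' m <= t') :
  exists (X : finType) (F : {set {set X}}),
    (maker_can_occupy F m b Maker s t /\
     breaker_can_restrict F m b Maker s t) /\
    (maker_can_occupy F m b Breaker s' t' /\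
     breaker_can_restrict F m b Breaker s' t').
Proof.
have size_split k : 2 * m + 1 <= k ->
    exists q r, [/\ k = m * q + r, 0 < r <= m & 1 < q].
  move=> km; exists (k.-1 %/ m), (k.-1 %% m).+1; split.
  - by rewrite addnS mulnC -divn_eq; lia.
  - by rewrite ltn_mod hm.
  by rewrite leq_divRL //; lia.
have [q [c [sE cP q1]]] := size_split s hs2m.
have [q' [c' [s'E c'P q'1]]] := size_split s' (leq_trans hs2m hss').
(* The nonempty tail needs a move beyond those for the core blocks. *)
have q_lt k r d u : k = m * r + d -> 0 < d -> ceil_div k m <= u -> r < u.
  move=> -> d0; rewrite ceil_div_leq // => le.
  by rewrite -(ltn_pmul2l hm) (mulnC m u); lia.
have c0 : 0 < c by case/andP: cP.
have c'0 : 0 < c' by case/andP: c'P.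
have [A [root [szA foA hoA killA]]] := exists_gadget hb q1 (q_lt _ _ _ _ sE c0 hts).
have [B [_ [szB foB hoB _]]] := exists_gadget hb q'1 (q_lt _ _ _ _ s'E c'0 hts').
pose H := combine b A B.
pose wt (e : edge H) := if e is inl _ then c else c'.
have szH (e : edge H) : #|core e| = if e is inl _ then q else q'.
  case: e => [e|[p e]] /=; first by rewrite card_imset ?szA // => x y [].
  by rewrite card_imset ?szB // => x y [].
have wtP e : 0 < wt e <= m by case: e.
have sizeH (e : edge H) : m * #|core e| + wt e = if e is inl _ then s else s'.
  by rewrite szH; case: e => [e|[p e]] /=.
have coreN0 (e : edge H) : exists v, v \in core e.
  by apply/set0Pn; rewrite -card_gt0 szH; case: e => [e|e]; exact: ltnW.
exists (elt m b H), (winning_sets m b wt); split; split.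
- apply: (@forces_maker_can_occupy m b H wt) => //.
  (* Confined to [A], Maker can only complete winning sets of size [s]. *)
  exists [set inl v | v : vertex A].
    move=> e eU; rewrite sizeH; case: e eU => // -[p e] /subsetP eU.
    have [v ve] := coreN0 (inr (p, e)); have /imsetP[w _ vw] := eU v ve.
    by move: ve; rewrite vw => /imsetP[].
  apply: (@forces_embed b A H inl inl _ t set0 set0 set0) foA => //.
  - by move=> x y [].
  - by move=> x y [].
  - by apply/subsetP => _ /imsetP[v _ ->]; exact: imset_f.
  - by move=> e; exact: subsetUl.
  - by apply/setP => x; rewrite !inE.
  - by apply/subsetP => x; rewrite !inE.
  - by apply/subsetP => x; rewrite !inE.
- apply: (@holds_breaker_can_restrict m b H wt (fun r _ => 0 < r)) => //.
  + by move=> r _; lia.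
  + by move=> e _; rewrite sizeH; case: e.
  (* Breaker can hold [B] for [t'] rounds, hence for [t]. *)
  have hoB' : holds b (fun r (_ : edge B) => 0 < r) t set0 set0 set0.
    by apply: holds_leq hoB => //; rewrite disjoints_subset sub0set.
  have := @combine_holds b A B (fun r _ => 0 < r) _ _ t set0 _ _ hoA hoB'.
  by rewrite imset0; apply.
- pose copy (p : 'I_b.+1) : {set vertex H} := [set inr (p, v) | v : vertex B].
  have size_copy p (e : edge H) : core e \subset copy p -> m * #|core e| + wt e = s'.
    move=> eU; rewrite sizeH; case: e eU => // e /subsetP eU.
    have [v ve] := coreN0 (inl e); have /imsetP[w _ vw] := eU v ve.
    by move: ve; rewrite vw => /imsetP[].
  have copy_forces p (Y : {set vertex H + edge H}) :
      (forall y, y \in Y -> match y with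
         | inl (inr (k, _)) => k != p | inr (inr (k, _)) => k != p | _ => true end) ->
      forces b (copy p) t' set0 (inl @^-1: Y) (inr @^-1: Y).
    move=> HY; apply: (@forces_embed b B H (fun v => inr (p, v)) (fun e => inr (p, e))
      _ t' set0 set0 set0) foB => //.
    - by move=> x y [].
    - by move=> x y [].
    - by apply/subsetP => _ /imsetP[v _ ->]; exact: imset_f.
    - by move=> e; exact: subsetUl.
    - by apply/setP => x; rewrite !inE.
    - by apply/subsetP => x; rewrite !inE => /HY; rewrite eqxx.
    - by apply/subsetP => x; rewrite !inE => /HY; rewrite eqxx.
  apply: (@forces_maker_can_occupy m b H wt) => // Y Yb.
  pose k (y : vertex H + edge H) : option 'I_b.+1 :=
    match y with inl (inr (p, _)) | inr (inr (p, _)) => Some p | _ => None end.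
  have [p Hp] := spare_copy k Yb; exists (copy p); first exact: size_copy.
  by apply: copy_forces => -[[v|[p' v]]|[e|[p' e]]] // /Hp.
(* Edges of [A] stay guarded forever, its root being killed at the outset; edges of [B], of size
   [s'], are guarded only while the clock runs. *)
- apply: (@holds_breaker_can_restrict m b H wt
    (fun r e => (0 < r) || (if e is inl _ then true else false))) => //.
  + by move=> r e /orP[r0|->]; rewrite ?orbT //; apply/orP; left; lia.
  + by move=> r e ->.
  + by move=> e; rewrite sizeH; case: e.
  exists (inl root).
  have := @combine_holds b A B (fun r e => (0 < r) || (if e is inl _ then true else false))
    _ _ t' [set root] _ _ (killA t') hoB.
  by rewrite imset_set1; apply=> // r p e; rewrite orbF.
Qed.
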